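(* Let $\rho=|\psi\rangle\langle\psi|$ be an $n$-qubit pure state, $S\subseteq[n]$ non-empty with $s=|S|$, and let $K\ge 2$, $L\ge 1$ be integers. Let $U_1,\dots,U_L$ be independent random local unitaries, each of the form $U_l=\bigotimes_{i\in S}U_{l,i}$ with independent Haar-random $U_{l,i}\in U(2)$ (identity outside $S$). Conditioned on $U_l$, let $\mathbf{Z}_{l,1},\dots,\mathbf{Z}_{l,K}\in\{0,1\}^s$ be independent outcomes, each distributed according to $P_{U_l}(\mathbf{z})=\operatorname{tr}\big(U_l\rho U_l^\dagger(|\mathbf{z}\rangle\langle\mathbf{z}|\otimes\mathbb{I}_{[n]\setminus S})\big)$ (computational-basis measurement of the qubits in $S$ after applying $U_l$). Define $$\hat S_l^{(K)}=\frac{1}{K(K-1)}\sum_{\substack{k,k'=1\\k\neq k'}}^K \mathbb{1}[\mathbf{Z}_{l,k}=\mathbf{Z}_{l,k'}],\qquad \hat{\mathcal{C}}_{|\psi\rangle}(S)=1-\Big(\tfrac32\Big)^s\frac1L\sum_{l=1}^L\hat S_l^{(K)}.$$ Then $\hat{\mathcal{C}}_{|\psi\rangle}(S)$ is an unbiased estimator of $\mathcal{C}_{|\psi\rangle}(S)$. Moreover, given a precision $\epsilon>0$ and confidence level $1-\delta\in(0,1)$, using at most $L=O\big((9/4)^s\log(1/\delta)/\epsilon^2\big)$ random unitaries (with an absolute implied constant) guarantees $\Pr\big[|\hat{\mathcal{C}}_{|\psi\rangle}(S)-\mathcal{C}_{|\psi\rangle}(S)|\ge\epsilon\big]\le\d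elta$.
   Context: $[n]=\{1,\dots,n\}$ labels the qubits. For an $n$-qubit pure state $|\psi\rangle$ and a non-empty $S\subseteq[n]$ with $s=|S|$, the concentratable entanglement is $\mathcal{C}_{|\psi\rangle}(S)=1-\frac{1}{2^s}\sum_{\alpha\subseteq S}\operatorname{tr}(\rho_\alpha^2)$, where $\rho_\alpha$ is the reduced state of $|\psi\rangle\langle\psi|$ on the qubits in $\alpha$, and $\operatorname{tr}(\rho_\emptyset^2):=1$. $\mathbb{1}[A]$ is $1$ if $A$ holds and $0$ otherwise.
   Formalization: log(1/δ) is replaced by log(2/δ), since with an absolute constant the claim fails as δ→1 (one qubit, K=2, L=1, ε=1/2: deviation probability 1); every L above the threshold is shown to work, and Haar measure on U(2) is given by an explicit parametrization. *)

(* Defs.v *)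
From HB Require Import structures.
From mathcomp Require Import all_boot all_order all_algebra.
From mathcomp Require Import all_classical all_reals all_analysis.
From mathcomp Require Import complex.

Set Implicit Arguments.
Unset Strict Implicit.
Unset Printing Implicit Defensive.

Import Order.TTheory GRing.Theory Num.Theory.
Local Open Scope ring_scope.

(* n-qubit computational basis: bit strings x : 'I_n -> bool.             *)
(* A pure state |psi> is its amplitude vector psi : bits n -> R[i].       *)
Definition bits (n : nat) := {ffun 'I_n -> bool}.

Definition sqnorm (R : realType) (z : R[i]) : R := complex.Re z ^+ 2 + complex.Im z ^+ 2.

Definition normalized (R : realType) (n : nat) (psi : bits n -> R[i]) : Prop :=
  \sum_(x : bits n) sqnorm (psi x) = 1.

Definition mixb (n : nat) (A : {set 'I_n}) (x y : bits n) : bits n :=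
  [ffun i => if i \in A then x i else y i].

(* x is zero on A (used to pick one representative per configuration of
   the qubits outside A) *)
Definition zero_on (n : nat) (A : {set 'I_n}) (x : bits n) : bool :=
  [forall i in A, x i == false].

(* Entries of the reduced density matrix rho_alpha of |psi><psi| on the
   qubits in alpha (partial trace over the complement of alpha).  Row and
   column indices are configurations of the qubits of alpha, represented by
   strings that are zero outside alpha. *)
Definition rdm (R : realType) (n : nat) (psi : bits n -> R[i])
    (alpha : {set 'I_n}) (x y : bits n) : R[i] :=
  \sum_(z : bits n | zero_on alpha z)
     psi (mixb alpha x z) * Num.conj (psi (mixb alpha y z)).

Definition purity (R : realType) (n : nat) (psi : bits n -> R[i])
    (alpha : {set 'I_n}) : R :=
  if alpha == finset.set0 then 1 else
  complex.Re (\sum_(x : bits n | zero_on (~: alpha) x)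
        \sum_(y : bits n | zero_on (~: alpha) y)
           rdm psi alpha x y * rdm psi alpha y x).

Definition concentratable_entanglement (R : realType) (n : nat)
    (psi : bits n -> R[i]) (S : {set 'I_n}) : R :=
  1 - (2 ^+ #|S|)^-1 * \sum_(alpha : {set 'I_n} | alpha \subset S) purity psi alpha.

Definition qS (n : nat) (S : {set 'I_n}) := {i : 'I_n | i \in S}.

Definition outcome (n : nat) (S : {set 'I_n}) := {ffun qS S -> bool}.

Definition b2o (b : bool) : 'I_2 := if b then ord_max else ord0.

(* (U psi)(w) for U = (tensor_{j in S} V j) (tensor identity outside S) *)
Definition apply_local (R : realType) (n : nat) (S : {set 'I_n})
    (V : qS S -> 'M[R[i]]_2) (psi : bits n -> R[i]) (w : bits n) : R[i] :=
  \sum_(v : bits n | [forall i in ~: S, v i == w i])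
     (\prod_(j : qS S) V j (b2o (w (val j))) (b2o (v (val j)))) * psi v.

(* P_U(z) = tr(U rho U^dagger (|z><z| (x) I_{[n]\S})) *)
Definition meas_prob (R : realType) (n : nat) (S : {set 'I_n})
    (V : qS S -> 'M[R[i]]_2) (psi : bits n -> R[i]) (z : outcome S) : R :=
  \sum_(w : bits n | [forall j : qS S, w (val j) == z j])
     sqnorm (apply_local V psi w).

(* Haar measure on U(2), realised as the image of the uniform measure on   *)
(* [0,1]^4 under (t,a,b,p) |->                                             *)
(*   [[ sqrt(1-t) e(a), -e(p) sqrt t conj(e(b)) ],                         *)
(*    [ sqrt t e(b),     e(p) sqrt(1-t) conj(e(a)) ]],  e(x) = exp(2 pi i x)*)
(* i.e. (first column uniform on the unit sphere S^3 of C^2 in Hopf        *)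
(* coordinates) times an independent uniform phase.          *)
Definition expi (R : realType) (x : R) : R[i] :=
  (cos (2 * pi * x) +i* sin (2 * pi * x))%C.

Definition haarU (R : realType) (th : 'I_4 -> R) : 'M[R[i]]_2 :=
  let t := th 0 in let a := th 1 in let b := th 2 in let p := th 3 in
  let c := ((Num.sqrt (1 - t))%:C)%C in let s := ((Num.sqrt t)%:C)%C in
  \matrix_(i < 2, j < 2)
    if (i == 0 :> nat) then
      (if (j == 0 :> nat) then c * expi a else - (expi p * s * Num.conj (expi b)))
    else
      (if (j == 0 :> nat) then s * expi b else expi p * c * Num.conj (expi a)).

(* Expectation over independent uniform variables on [0,1] indexed by a
   finite type I, written as the iterated Lebesgue integral over [0,1]^I *)
Fixpoint unif_iint (R : realType) (I : eqType) (l : seq I)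
    (f : (I -> R) -> \bar R) (th : I -> R) : \bar R :=
  match l with
  | [::] => f th
  | i :: l' => (\int[@lebesgue_measure R]_(x in `[0%R, 1%R])
                  unif_iint l' f (fun j => if j == i then x else th j))%E
  end.

Definition unif_E (R : realType) (I : finType) (f : (I -> R) -> \bar R) : \bar R :=
  unif_iint (enum I) f (fun _ => 0).

(* random parameters: for each round l < L, each qubit j of S, 4 uniforms *)
Definition params (n : nat) (S : {set 'I_n}) (L : nat) :=
  ('I_L * qS S * 'I_4)%type.

Definition locU (R : realType) (n : nat) (S : {set 'I_n}) (L : nat)
    (th : params S L -> R) (l : 'I_L) : qS S -> 'M[R[i]]_2 :=
  fun j => haarU (fun r => th (l, j, r)).

Definition Shat (R : realType) (n : nat) (S : {set 'I_n}) (L K : nat)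
    (Z : {ffun 'I_L * 'I_K -> outcome S}) (l : 'I_L) : R :=
  (K * (K - 1))%:R^-1 *
    \sum_(k : 'I_K) \sum_(k' : 'I_K | k' != k) (Z (l, k) == Z (l, k'))%:R.

Definition Chat (R : realType) (n : nat) (S : {set 'I_n}) (L K : nat)
    (Z : {ffun 'I_L * 'I_K -> outcome S}) : R :=
  1 - (3 / 2) ^+ #|S| * (L%:R^-1 * \sum_(l : 'I_L) Shat R Z l).

Definition outcomes_weight (R : realType) (n : nat) (psi : bits n -> R[i])
    (S : {set 'I_n}) (L K : nat) (th : params S L -> R)
    (Z : {ffun 'I_L * 'I_K -> outcome S}) : R :=
  \prod_(lk : 'I_L * 'I_K) meas_prob (locU th lk.1) psi (Z lk).

Definition Chat_expectation (R : realType) (n : nat) (psi : bits n -> R[i])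
    (S : {set 'I_n}) (L K : nat) : \bar R :=
  unif_E (fun th : params S L -> R =>
    (\sum_(Z : {ffun 'I_L * 'I_K -> outcome S})
        outcomes_weight psi th Z * Chat R Z)%:E).

Definition Chat_deviation_prob (R : realType) (n : nat) (psi : bits n -> R[i])
    (S : {set 'I_n}) (L K : nat) (eps : R) : \bar R :=
  unif_E (fun th : params S L -> R =>
    (\sum_(Z : {ffun 'I_L * 'I_K -> outcome S})
        outcomes_weight psi th Z *
        ((eps <= `|Chat R Z - concentratable_entanglement psi S|)%R)%:R)%:E).

(* Main.v *)
(* Given the unitaries, the mean of S_l is the collision probability
   sum_z P_U(z)^2.  Averaging over the Haar measure qubit by qubit replaces the
   factor sum_b V_bx conj(V_bx') V_by conj(V_by') by one third of
   [x = x'][y = y'] + [x = y'][y = x'] (identity plus swap); expanding the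
   product over S by the set alpha of swapped qubits gives
   3^-s sum_(alpha <= S) tr(rho_alpha^2), hence unbiasedness.  For the deviation
   bound, the S_l are independent and [0, 1]-valued, so Chernoff's method with
   exp(x) <= 1 + x + 2 x^2 on [-1/2, 1/2] gives the tail
   2 exp(- L t^2 / 8) with t = eps (2/3)^s. *)
Require Import Defs.
From HB Require Import structures.
From mathcomp Require Import all_boot all_order all_algebra.
From mathcomp Require Import all_classical all_reals all_analysis.
From mathcomp Require Import complex ring lra.

Set Implicit Arguments.
Unset Strict Implicit.
Unset Printing Implicit Defensive.

Import Order.TTheory GRing.Theory Num.Theory.
Import numFieldNormedType.Exports.
Local Open Scope ring_scope.

(** * Iterated integrals over the unit cube *)

(** [unif_E] is a bare iterated integral, so independence cannot be quoted from probability theory.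
    It becomes a statement about functions that read disjoint sets of parameters and is proved one
    coordinate at a time. The square roots in [haarU] truncate at 0, so its columns are orthonormal
    only while the first parameter lies in [0, 1]. Outcome probabilities are therefore normalized
    only on the unit cube, and integrands have to be compared there rather than as functions. Each
    entry of [haarU] is a real amplitude times characters of three independent phases. The second
    moment thus reduces to orthogonality of characters and to the integrals of t^2, (1-t)^2 and
    t(1-t). One row contributes 1/6 of the two pairings, and the two rows add up to the factor 1/3.
    For fixed unitaries a round is centred at its own collision probability, not at the target
    value. Centring appears only after the Haar average, so the exponential has to be bounded by a
    polynomial whose linear term can still be averaged. *)

Definition int01 (R : realType) (g : R -> R) : R :=
  (\int[@lebesgue_measure R]_(x in `[0%R, 1%R]%classic) g x)%R.

Lemma integrable01 (R : realType) (g : R -> R) : continuous g ->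
  (@lebesgue_measure R).-integrable `[0%R, 1%R]%classic (EFin \o g).
Proof.
move=> cg; apply: continuous_compact_integrable; first exact: segment_compact.
exact: continuous_subspaceT.
Qed.

Lemma int01_fin (R : realType) (g : R -> R) : continuous g ->
  (\int[@lebesgue_measure R]_(x in `[0%R, 1%R]%classic) (g x)%:E = (int01 g)%:E)%E.
Proof.
move=> cg; rewrite /int01 /Rintegral fineK//; apply: integrable_fin_num => //.
exact: integrable01.
Qed.

Lemma int01D (R : realType) (f g : R -> R) : continuous f -> continuous g ->
  int01 (fun x => f x + g x) = int01 f + int01 g.
Proof. by move=> cf cg; apply: RintegralD => //; exact: integrable01. Qed.

Lemma int01Z (R : realType) (c : R) (g : R -> R) : continuous g ->
  int01 (fun x => c * g x) = c * int01 g.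
Proof. by move=> cg; apply: RintegralZl => //; exact: integrable01. Qed.

Lemma int01_cst (R : realType) (c : R) : int01 (fun=> c) = c.
Proof.
rewrite /int01 Rintegral_cst//= lebesgue_measure_itv /= lte_fin ltr01.
by rewrite -EFinD subr0 mulr1.
Qed.

Lemma le_int01 (R : realType) (f g : R -> R) : continuous f -> continuous g ->
  (forall x, 0 <= x <= 1 -> f x <= g x) -> int01 f <= int01 g.
Proof.
move=> cf cg fg; apply: le_Rintegral => //; try exact: integrable01.
Qed.

Lemma int01_FTC (R : realType) (f F : R -> R) : continuous f ->
  (forall x : R, is_derive x (1 : R) F (f x)) -> int01 f = F 1 - F 0.
Proof.
move=> cf dF; apply: EFin_inj; rewrite -int01_fin// EFinB.
apply: continuous_FTC2 => //.
- exact: continuous_subspaceT.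
- have cF : continuous F.
    by move=> x; apply: differentiable_continuous; apply/derivable1_diffP.
  split => //.
  + by apply: cvg_at_right_filter; exact: cF.
  + by apply: cvg_at_left_filter; exact: cF.
- by move=> x _; rewrite derive1E; apply: derive_val.
Qed.

Definition upd (R : Type) (I : eqType) (th : I -> R) (i : I) (x : R) : I -> R :=
  fun j => if j == i then x else th j.

(* The span of products of continuous functions of one coordinate: it contains
   all the integrands below and is stable under integrating out a coordinate,
   so that no product measure is needed. *)
Inductive nice (R : realType) (I : eqType) : ((I -> R) -> R) -> Prop :=
| nice_coord i (g : R -> R) of continuous g : nice (fun th => g (th i))
| nice_cst c : nice (fun=> c)
| nice_add f g of nice f & nice g : nice (fun th => f th + g th)
| nice_mul f g of nice f & nice g : nice (fun th => f th * g th).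

(** Separation of variables: a sum concatenates the two index types, a product multiplies them.
    Continuity in the integrated variable and stability under integration both follow, since
    integrating in [x] only replaces [a k] by a constant. *)
Lemma nice_split (R : realType) (I : eqType) (f : (I -> R) -> R) (i : I) :
  nice f -> exists (K : finType) (a : K -> R -> R) (b : K -> (I -> R) -> R),
    [/\ forall k, continuous (a k), forall k, nice (b k) &
        forall th x, f (upd th i x) = \sum_k a k x * b k th].
Proof.
elim=> [j g cg|c|f1 f2 _ [K1 [a1 [b1 [ca1 nb1 e1]]]] _ [K2 [a2 [b2 [ca2 nb2 e2]]]]
  |f1 f2 _ [K1 [a1 [b1 [ca1 nb1 e1]]]] _ [K2 [a2 [b2 [ca2 nb2 e2]]]]].
- exists unit; rewrite /upd; have [_|_] := eqVneq j i.
    exists (fun=> g), (fun _ _ => 1); split => // [_|th x]; first exact: nice_cst.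
    by rewrite big_const card_unit/= addr0 mulr1.
  exists (fun _ _ => 1), (fun _ th => g (th j)); split => // [_|_|th x].
  + by move=> ?; exact: cvg_cst.
  + exact: (nice_coord j cg).
  + by rewrite big_const card_unit/= addr0 mul1r.
- exists unit, (fun _ _ => 1), (fun _ _ => c); split => [_||th x].
  + by move=> ?; exact: cvg_cst.
  + by move=> _; exact: nice_cst.
  + by rewrite big_const card_unit/= addr0 mul1r.
- exists (K1 + K2)%type,
    (fun k => match k with inl k => a1 k | inr k => a2 k end),
    (fun k => match k with inl k => b1 k | inr k => b2 k end).
  by split => [[]|[]|th x] //; rewrite big_sumType/= e1 e2.
- exists (K1 * K2)%type, (fun k x => a1 k.1 x * a2 k.2 x),
    (fun k th => b1 k.1 th * b2 k.2 th); split => [k x|k|th x].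
  + by apply: continuousM; [exact: ca1|exact: ca2].
  + exact: nice_mul.
  + rewrite e1 e2 big_distrlr/= pair_big/=; apply: eq_bigr => k _.
    by rewrite mulrACA.
Qed.

Lemma continuous_sum (R : realType) (K : Type) (r : seq K) (g : K -> R -> R) :
  (forall k, continuous (g k)) -> continuous (fun x => \sum_(k <- r) g k x).
Proof.
move=> cg; elim: r => [|k r IH] x.
  by under eq_fun do rewrite big_nil; exact: cvg_cst.
under eq_fun do rewrite big_cons; apply: continuousD; [exact: cg|exact: IH].
Qed.

Lemma int01_sum (R : realType) (K : Type) (r : seq K) (g : K -> R -> R) :
  (forall k, continuous (g k)) ->
  int01 (fun x => \sum_(k <- r) g k x) = \sum_(k <- r) int01 (g k).
Proof.
move=> cg; elim: r => [|k r IH].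
  by under eq_fun do rewrite big_nil; rewrite big_nil int01_cst.
under eq_fun do rewrite big_cons; rewrite big_cons int01D ?IH//.
exact: continuous_sum.
Qed.

Lemma nice_upd_continuous (R : realType) (I : eqType) (f : (I -> R) -> R) th i :
  nice f -> continuous (fun x => f (upd th i x)).
Proof.
move=> /(nice_split i)[K [a [b [ca nb e]]]].
under eq_fun do rewrite e.
apply: continuous_sum => k x.
by apply: continuousM; [exact: ca|exact: cvg_cst].
Qed.

Lemma nice_sum (R : realType) (I : eqType) (K : Type) (r : seq K) (P : pred K)
    (f : K -> (I -> R) -> R) :
  (forall k, P k -> nice (f k)) -> nice (fun th => \sum_(k <- r | P k) f k th).
Proof.
move=> nf; elim: r => [|k r IH].
  by under eq_fun do rewrite big_nil; exact: nice_cst.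
under eq_fun do rewrite big_cons.
by case Pk: (P k) => //; apply: nice_add => //; exact: nf.
Qed.

Lemma nice_prod (R : realType) (I : eqType) (K : Type) (r : seq K) (P : pred K)
    (f : K -> (I -> R) -> R) :
  (forall k, P k -> nice (f k)) -> nice (fun th => \prod_(k <- r | P k) f k th).
Proof.
move=> nf; elim: r => [|k r IH].
  by under eq_fun do rewrite big_nil; exact: nice_cst.
under eq_fun do rewrite big_cons.
by case Pk: (P k) => //; apply: nice_mul => //; exact: nf.
Qed.

Lemma nice_int01 (R : realType) (I : eqType) (f : (I -> R) -> R) i :
  nice f -> nice (fun th => int01 (fun x => f (upd th i x))).
Proof.
move=> /(nice_split i)[K [a [b [ca nb e]]]].
have -> : (fun th => int01 (fun x => f (upd th i x))) =
          (fun th => \sum_k int01 (a k) * b k th).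
  apply: funext => th; under eq_fun do rewrite e.
  rewrite int01_sum => [|k x]; last first.
    by apply: continuousM; [exact: ca|exact: cvg_cst].
  apply: eq_bigr => k _; rewrite mulrC -int01Z//.
  by congr int01; apply: funext => x; rewrite mulrC.
by apply: nice_sum => k _; apply: nice_mul => //; exact: nice_cst.
Qed.

Fixpoint iterE (R : realType) (I : eqType) (l : seq I) (f : (I -> R) -> R)
    (th : I -> R) : R :=
  match l with
  | [::] => f th
  | i :: l' => int01 (fun x => iterE l' f (upd th i x))
  end.

Definition depends_on (R : Type) (I : eqType) (T : Type) (A : pred I)
    (f : (I -> R) -> T) : Prop :=
  forall th th', (forall i, A i -> th i = th' i) -> f th = f th'.

Definition unit_cube (R : realType) (I : eqType) (th : I -> R) : Prop :=
  forall i, 0 <= th i <= 1.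

Lemma nice_iterE (R : realType) (I : eqType) (l : seq I) (f : (I -> R) -> R) :
  nice f -> nice (iterE l f).
Proof.
by move=> nf; elim: l => [|i l IH] //=; exact: (nice_int01 i IH).
Qed.

Lemma unif_iintE (R : realType) (I : eqType) (l : seq I) (f : (I -> R) -> R) th :
  nice f -> unif_iint l (fun th => (f th)%:E) th = (iterE l f th)%:E.
Proof.
move=> nf; elim: l th => [|i l IH] th //=.
rewrite -int01_fin; last by apply: nice_upd_continuous; exact: nice_iterE.
by apply: eq_integral => x _; rewrite IH.
Qed.

Lemma iterE_D (R : realType) (I : eqType) (l : seq I) (f g : (I -> R) -> R) th :
  nice f -> nice g ->
  iterE l (fun th => f th + g th) th = iterE l f th + iterE l g th.
Proof.
move=> nf ng; elim: l th => [|i l IH] th //=.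
under eq_fun do rewrite IH.
by rewrite int01D//; apply: nice_upd_continuous; exact: nice_iterE.
Qed.

Lemma iterE_cst (R : realType) (I : eqType) (l : seq I) (c : R) th :
  iterE l (fun=> c) th = c.
Proof.
elim: l th => [|i l IH] th //=.
by under eq_fun do rewrite IH; rewrite int01_cst.
Qed.

Lemma unit_cube_upd (R : realType) (I : eqType) (th : I -> R) i x :
  unit_cube th -> 0 <= x <= 1 -> unit_cube (upd th i x).
Proof. by move=> cth x01 j; rewrite /upd; case: ifP. Qed.

Lemma le_iterE (R : realType) (I : eqType) (l : seq I) (f g : (I -> R) -> R) th :
  nice f -> nice g -> (forall th, unit_cube th -> f th <= g th) ->
  unit_cube th -> iterE l f th <= iterE l g th.
Proof.
move=> nf ng fg; elim: l th => [|i l IH] th cth /=; first exact: fg.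
apply: le_int01; try by apply: nice_upd_continuous; exact: nice_iterE.
by move=> x x01; apply/IH/unit_cube_upd.
Qed.

Lemma depends_on_iterE (R : realType) (I : eqType) (l : seq I) (A : pred I)
    (f : (I -> R) -> R) : depends_on A f -> depends_on A (iterE l f).
Proof.
move=> df; elim: l => [|i l IH] //= th th' e.
congr int01; apply: funext => x; apply: IH => j Aj.
by rewrite /upd; case: ifP => // _; exact: e.
Qed.

(** Each coordinate is read by at most one of the two factors, so at each integration the other
    factor is constant and comes out of the integral. *)
Lemma iterE_indep (R : realType) (I : eqType) (l : seq I) (A B : pred I)
    (f g : (I -> R) -> R) th :
  nice f -> nice g -> depends_on A f -> depends_on B g ->
  (forall i, A i -> ~~ B i) ->
  iterE l (fun th => f th * g th) th = iterE l f th * iterE l g th.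
Proof.
move=> nf ng df dg AB; elim: l th => [|i l IH] th //=.
under eq_fun do rewrite IH.
have cl h x : nice h -> continuous (fun x => iterE l h (upd th i x)).
  by move=> nh; apply: nice_upd_continuous; exact: nice_iterE.
(* Turns [depends_on] into constancy in the integrated variable; below, the value 0 serves as
   reference point. *)
have const C h : depends_on C h -> ~~ C i ->
    forall x y, iterE l h (upd th i x) = iterE l h (upd th i y).
  move=> dh Ci x y; apply: (depends_on_iterE l dh) => j Cj; rewrite /upd.
  by case: eqVneq => // ji; rewrite ji (negbTE Ci) in Cj.
have [/AB Bi|Ai] := boolP (A i).
  have e x := const _ _ dg Bi x 0.
  under eq_fun do rewrite (e _) mulrC; rewrite int01Z; last exact: cl.
  by rewrite mulrC; congr (_ * _); under [in RHS]eq_fun do rewrite (e _);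
    rewrite int01_cst.
have e x := const _ _ df Ai x 0.
under eq_fun do rewrite (e _); rewrite int01Z; last exact: cl.
by congr (_ * _); under [in RHS]eq_fun do rewrite (e _); rewrite int01_cst.
Qed.

Lemma iterE_coord (R : realType) (I : eqType) (l : seq I) (i : I) (g : R -> R) th :
  i \in l -> continuous g -> iterE l (fun th => g (th i)) th = int01 g.
Proof.
move=> + cg; elim: l th => [|j l IH] th //=; rewrite inE.
(* Entries of [l] may repeat: an inner integration over [i] overwrites the outer value, so only the
   last occurrence counts. *)
have [il _|il] := boolP (i \in l).
  by under eq_fun do rewrite (IH _ il); rewrite int01_cst.
rewrite orbF => /eqP <- {j IH}; congr int01; apply: funext => x.
have : forall th' : I -> R, th' i = x -> iterE l (fun th => g (th i)) th' = g x.
  elim: l il => [|j l IH] /=; first by move=> _ th' ->.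
  rewrite inE negb_or => /andP[ij il] th' e.
  under eq_fun do rewrite IH// ?/upd ?(negbTE ij)//.
  by rewrite int01_cst.
by apply; rewrite /upd eqxx.
Qed.

Definition expect (R : realType) (I : finType) (f : (I -> R) -> R) : R :=
  iterE (enum I) f (fun=> 0).

Lemma unif_E_expect (R : realType) (I : finType) (f : (I -> R) -> R) :
  nice f -> unif_E (fun th => (f th)%:E) = (expect f)%:E.
Proof. by move=> nf; rewrite /unif_E unif_iintE. Qed.

Lemma expectD (R : realType) (I : finType) (f g : (I -> R) -> R) :
  nice f -> nice g ->
  expect (fun th => f th + g th) = expect f + expect g.
Proof. exact: iterE_D. Qed.

Lemma expect_cst (R : realType) (I : finType) (c : R) :
  expect (fun _ : I -> R => c) = c.
Proof. exact: iterE_cst. Qed.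

Lemma le_expect (R : realType) (I : finType) (f g : (I -> R) -> R) :
  nice f -> nice g -> (forall th, unit_cube th -> f th <= g th) ->
  expect f <= expect g.
Proof. by move=> nf ng fg; apply: le_iterE => // i; rewrite lexx ler01. Qed.

(** Equality on the cube is the usable hypothesis, because normalization of the outcome weights
    fails for parameters outside [0, 1]. *)
Lemma eq_expect (R : realType) (I : finType) (f g : (I -> R) -> R) :
  nice f -> nice g -> (forall th, unit_cube th -> f th = g th) ->
  expect f = expect g.
Proof.
move=> nf ng fg; apply/eqP; rewrite eq_le.
by apply/andP; split; apply: le_expect => // th /fg ->.
Qed.

Lemma expect_indep (R : realType) (I : finType) (A B : pred I)
    (f g : (I -> R) -> R) :
  nice f -> nice g -> depends_on A f -> depends_on B g ->
  (forall i, A i -> ~~ B i) ->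
  expect (fun th => f th * g th) = expect f * expect g.
Proof. by move=> nf ng df dg AB; apply: (iterE_indep _ _ nf ng df dg AB). Qed.

Lemma expect_coord (R : realType) (I : finType) (i : I) (g : R -> R) :
  continuous g -> expect (fun th => g (th i)) = int01 g.
Proof. by move=> cg; rewrite /expect iterE_coord// mem_enum. Qed.

Lemma expectZ (R : realType) (I : finType) (c : R) (f : (I -> R) -> R) :
  nice f -> expect (fun th => c * f th) = c * expect f.
Proof.
move=> nf; rewrite (expect_indep (A := pred0) (B := predT))//.
- by rewrite expect_cst.
- exact: nice_cst.
- by move=> th th' e; congr f; apply: funext => i; exact: e.
Qed.

Lemma expect_sum (R : realType) (I : finType) (K : Type) (r : seq K) (P : pred K)
    (f : K -> (I -> R) -> R) : (forall k, P k -> nice (f k)) ->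
  expect (fun th => \sum_(k <- r | P k) f k th) = \sum_(k <- r | P k) expect (f k).
Proof.
move=> nf; elim: r => [|k r IH].
  by under eq_fun do rewrite big_nil; rewrite big_nil expect_cst.
under eq_fun do rewrite big_cons; rewrite big_cons.
case Pk: (P k) => //; rewrite expectD ?IH//; first exact: nf.
exact: nice_sum.
Qed.

(** * Complex-valued integrands and Fourier characters *)

Definition niceC (R : realType) (I : eqType) (f : (I -> R) -> R[i]) : Prop :=
  nice (fun th => complex.Re (f th)) /\ nice (fun th => complex.Im (f th)).

Definition expectC (R : realType) (I : finType) (f : (I -> R) -> R[i]) : R[i] :=
  (expect (fun th => complex.Re (f th)) +i* expect (fun th => complex.Im (f th)))%C.

Lemma complex_ReD (R : realType) (z w : R[i]) :
  complex.Re (z + w) = complex.Re z + complex.Re w.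
Proof. by case: z; case: w. Qed.

Lemma complex_ImD (R : realType) (z w : R[i]) :
  complex.Im (z + w) = complex.Im z + complex.Im w.
Proof. by case: z; case: w. Qed.

Lemma complex_ReM (R : realType) (z w : R[i]) : complex.Re (z * w) =
  complex.Re z * complex.Re w + (-1) * (complex.Im z * complex.Im w).
Proof. by case: z => a b; case: w => c d /=; rewrite mulN1r. Qed.

Lemma complex_ImM (R : realType) (z w : R[i]) : complex.Im (z * w) =
  complex.Re z * complex.Im w + complex.Im z * complex.Re w.
Proof. by case: z; case: w. Qed.

Lemma niceC_cst (R : realType) (I : eqType) (c : R[i]) :
  niceC (fun _ : I -> R => c).
Proof. by split; exact: nice_cst. Qed.

Lemma niceC_real (R : realType) (I : eqType) (f : (I -> R) -> R) :
  nice f -> niceC (fun th => (f th)%:C%C).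
Proof. by move=> nf; split => //; exact: nice_cst. Qed.

Lemma niceC_add (R : realType) (I : eqType) (f g : (I -> R) -> R[i]) :
  niceC f -> niceC g -> niceC (fun th => f th + g th).
Proof.
move=> [nf1 nf2] [ng1 ng2]; split.
  by under eq_fun do rewrite complex_ReD; exact: nice_add.
by under eq_fun do rewrite complex_ImD; exact: nice_add.
Qed.

Lemma niceC_mul (R : realType) (I : eqType) (f g : (I -> R) -> R[i]) :
  niceC f -> niceC g -> niceC (fun th => f th * g th).
Proof.
move=> [nf1 nf2] [ng1 ng2]; split.
  under eq_fun do rewrite complex_ReM; apply: nice_add; first exact: nice_mul.
  by apply: nice_mul; [exact: nice_cst|exact: nice_mul].
by under eq_fun do rewrite complex_ImM; apply: nice_add; exact: nice_mul.
Qed.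

Lemma niceC_conj (R : realType) (I : eqType) (f : (I -> R) -> R[i]) :
  niceC f -> niceC (fun th => Num.conj (f th)).
Proof.
move=> [nf1 nf2]; split.
  by have -> : (fun th => complex.Re (Num.conj (f th))) =
    (fun th => complex.Re (f th)) by apply: funext => th; case: (f th).
have -> : (fun th => complex.Im (Num.conj (f th))) =
    (fun th => -1 * complex.Im (f th)).
  by apply: funext => th; case: (f th) => a b /=; rewrite mulN1r.
by apply: nice_mul => //; exact: nice_cst.
Qed.

Lemma niceC_sum (R : realType) (I : eqType) (K : Type) (r : seq K) (P : pred K)
    (f : K -> (I -> R) -> R[i]) :
  (forall k, P k -> niceC (f k)) -> niceC (fun th => \sum_(k <- r | P k) f k th).
Proof.
move=> nf; elim: r => [|k r IH].
  by under eq_fun do rewrite big_nil; exact: niceC_cst.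
under eq_fun do rewrite big_cons.
by case Pk: (P k) => //; apply: niceC_add => //; exact: nf.
Qed.

Lemma niceC_prod (R : realType) (I : eqType) (K : Type) (r : seq K) (P : pred K)
    (f : K -> (I -> R) -> R[i]) :
  (forall k, P k -> niceC (f k)) -> niceC (fun th => \prod_(k <- r | P k) f k th).
Proof.
move=> nf; elim: r => [|k r IH].
  by under eq_fun do rewrite big_nil; exact: niceC_cst.
under eq_fun do rewrite big_cons.
by case Pk: (P k) => //; apply: niceC_mul => //; exact: nf.
Qed.

Lemma expectC_real (R : realType) (I : finType) (f : (I -> R) -> R) :
  expectC (fun th => (f th)%:C%C) = (expect f)%:C%C.
Proof. by rewrite /expectC /= expect_cst. Qed.

Lemma expectC_cst (R : realType) (I : finType) (c : R[i]) :
  expectC (fun _ : I -> R => c) = c.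
Proof. by rewrite /expectC !expect_cst; case: c. Qed.

Lemma expectCD (R : realType) (I : finType) (f g : (I -> R) -> R[i]) :
  niceC f -> niceC g ->
  expectC (fun th => f th + g th) = expectC f + expectC g.
Proof.
move=> [nf1 nf2] [ng1 ng2]; rewrite /expectC.
under eq_fun do rewrite complex_ReD; under [X in (_ +i* expect X)%C]eq_fun do rewrite complex_ImD.
by rewrite !expectD.
Qed.

Lemma expectC_sum (R : realType) (I : finType) (K : Type) (r : seq K) (P : pred K)
    (f : K -> (I -> R) -> R[i]) : (forall k, P k -> niceC (f k)) ->
  expectC (fun th => \sum_(k <- r | P k) f k th) = \sum_(k <- r | P k) expectC (f k).
Proof.
move=> nf; elim: r => [|k r IH].
  by under eq_fun do rewrite big_nil; rewrite big_nil expectC_cst.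
under eq_fun do rewrite big_cons; rewrite big_cons.
case Pk: (P k) => //; rewrite expectCD ?IH//; first exact: nf.
exact: niceC_sum.
Qed.

Lemma depends_on_comp (R : Type) (I : eqType) (T T' : Type) (A : pred I)
    (f : (I -> R) -> T) (h : T -> T') :
  depends_on A f -> depends_on A (fun th => h (f th)).
Proof. by move=> df th th' e; rewrite (df _ _ e). Qed.

Lemma expectC_indep (R : realType) (I : finType) (A B : pred I)
    (f g : (I -> R) -> R[i]) :
  niceC f -> niceC g -> depends_on A f -> depends_on B g ->
  (forall i, A i -> ~~ B i) ->
  expectC (fun th => f th * g th) = expectC f * expectC g.
Proof.
move=> [nf1 nf2] [ng1 ng2] df dg AB.
have df1 := depends_on_comp (@complex.Re R) df.
have df2 := depends_on_comp (@complex.Im R) df.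
have dg1 := depends_on_comp (@complex.Re R) dg.
have dg2 := depends_on_comp (@complex.Im R) dg.
rewrite /expectC; under eq_fun do rewrite complex_ReM.
under [X in (_ +i* expect X)%C]eq_fun do rewrite complex_ImM.
rewrite !expectD ?expectZ; do ?[exact: nice_mul|exact: nice_cst].
  rewrite !(expect_indep _ _ _ _ AB)//; apply/eqP; rewrite eq_complex/=.
  by rewrite mulN1r !eqxx.
by apply: nice_mul; [exact: nice_cst|exact: nice_mul].
Qed.

Lemma expectC_prod (R : realType) (I : finType) (K : eqType) (r : seq K)
    (A : K -> pred I) (f : K -> (I -> R) -> R[i]) :
  uniq r -> (forall k, niceC (f k)) -> (forall k, depends_on (A k) (f k)) ->
  (forall k k' i, k != k' -> A k i -> ~~ A k' i) ->
  expectC (fun th => \prod_(k <- r) f k th) = \prod_(k <- r) expectC (f k).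
Proof.
move=> + nf df dA; elim: r => [_|k r IH] /=.
  by under eq_fun do rewrite big_nil; rewrite big_nil expectC_cst.
move=> /andP[kr ur]; under eq_fun do rewrite big_cons.
rewrite big_cons -IH//.
apply: (expectC_indep (A := A k) (B := fun i => has (fun k' => A k' i) r)) => //.
- exact: niceC_prod.
- move=> th th' e; apply: eq_big_seq => k' k'r; apply: df => i Ai.
  by apply: e; apply/hasP; exists k'.
- move=> i Ai; apply/hasPn => k' k'r; apply: dA Ai.
  by apply: contraNneq kr => ->.
Qed.

Lemma expect_prod (R : realType) (I : finType) (K : eqType) (r : seq K)
    (A : K -> pred I) (f : K -> (I -> R) -> R) :
  uniq r -> (forall k, nice (f k)) -> (forall k, depends_on (A k) (f k)) ->
  (forall k k' i, k != k' -> A k i -> ~~ A k' i) ->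
  expect (fun th => \prod_(k <- r) f k th) = \prod_(k <- r) expect (f k).
Proof.
move=> ur nf df dA; apply: (@complexI R); rewrite -expectC_real rmorph_prod/=.
under eq_fun do rewrite rmorph_prod/=.
rewrite (expectC_prod (A := A) ur) => [|k|k|//].
- by apply: eq_bigr => k _; rewrite expectC_real.
- exact: niceC_real.
- by move=> th th' /df ->.
Qed.

(** * Characters of the circle and elementary integrals over [0, 1] *)

Definition int01C (R : realType) (g : R -> R[i]) : R[i] :=
  (int01 (fun x => complex.Re (g x)) +i* int01 (fun x => complex.Im (g x)))%C.

Definition continuousC (R : realType) (g : R -> R[i]) : Prop :=
  continuous (fun x => complex.Re (g x)) /\ continuous (fun x => complex.Im (g x)).

Lemma niceC_coord (R : realType) (I : eqType) (i : I) (g : R -> R[i]) :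
  continuousC g -> niceC (fun th : I -> R => g (th i)).
Proof.
by move=> [c1 c2]; split; [exact: (nice_coord i c1)|exact: (nice_coord i c2)].
Qed.

Lemma expectC_coords (R : realType) (I : finType) (K : eqType) (r : seq K)
    (q : K -> I) (g : K -> R -> R[i]) :
  uniq r -> injective q -> (forall k, continuousC (g k)) ->
  expectC (fun th => \prod_(k <- r) g k (th (q k))) = \prod_(k <- r) int01C (g k).
Proof.
move=> ur qi cg.
rewrite (expectC_prod (A := fun k i => i == q k) ur) => [|k|k th th' e|k k' i].
- apply: eq_bigr => k _; have [c1 c2] := cg k.
  by rewrite /expectC (expect_coord (q k) c1) (expect_coord (q k) c2).
- exact: niceC_coord.
- by rewrite e.
- by move=> kk /eqP ->; apply: contraNneq kk => /qi ->.
Qed.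

(* Characters of the circle, parametrized so that [expi = fourier 1]. *)
Definition fourier (R : realType) (m : int) (x : R) : R[i] :=
  (cos (m%:~R * (2 * pi * x)) +i* sin (m%:~R * (2 * pi * x)))%C.

Lemma fourierD (R : realType) (m n : int) (x : R) :
  fourier m x * fourier n x = fourier (m + n) x.
Proof.
rewrite /fourier; apply/eqP; rewrite eq_complex /=.
set y := 2 * pi * x; rewrite intrD (mulrDl _ _ y) cosD sinD;
  apply/andP; split; apply/eqP; ring.
Qed.

Lemma fourier0 (R : realType) (x : R) : fourier 0 x = 1.
Proof. by rewrite /fourier mul0r cos0 sin0. Qed.

Lemma conj_fourier (R : realType) (m : int) (x : R) :
  Num.conj (fourier m x) = fourier (- m) x.
Proof. by rewrite /fourier rmorphN mulNr cosN sinN. Qed.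

Lemma continuous_scale (R : realType) (k : R) : continuous (fun x : R => k * x).
Proof. by move=> x; apply: continuousM; [exact: cvg_cst|exact: cvg_id]. Qed.

Lemma fourier_continuous (R : realType) (m : int) : continuousC (@fourier R m).
Proof.
split => x /=; under eq_fun do rewrite mulrA.
  apply: (@continuous_comp _ _ _ _ cos); last exact: continuous_cos.
  exact: continuous_scale.
apply: (@continuous_comp _ _ _ _ sin); last exact: continuous_sin.
exact: continuous_scale.
Qed.

Lemma sin2pi_int (R : realType) (m : int) : sin (m%:~R * (2 * pi)) = 0 :> R.
Proof.
have e n : sin (n%:R * (2 * pi)) = 0 :> R.
  have := periodicn (@sinD2pi R) n 0; rewrite add0r sin0 => h; rewrite -[RHS]h.
  by congr sin; rewrite [2 * pi]mulr_natl mulr_natl.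
by case: m => n; rewrite ?NegzE ?rmorphN/= ?mulNr ?sinN -pmulrn e ?oppr0.
Qed.

Lemma cos2pi_int (R : realType) (m : int) : cos (m%:~R * (2 * pi)) = 1 :> R.
Proof.
have e n : cos (n%:R * (2 * pi)) = 1 :> R.
  have := periodicn (@cosD2pi R) n 0; rewrite add0r cos0 => h; rewrite -[RHS]h.
  by congr cos; rewrite [2 * pi]mulr_natl mulr_natl.
by case: m => n; rewrite ?NegzE ?rmorphN/= ?mulNr ?cosN -pmulrn e.
Qed.

(** For nonzero [m] the antiderivatives are sin(k x)/k and -cos(k x)/k with k = 2 pi m; they have
    period 1, so the boundary terms cancel. *)
Lemma int01C_fourier (R : realType) (m : int) :
  int01C (@fourier R m) = (m == 0)%:R.
Proof.
have [->|m0] := eqVneq m 0.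
  rewrite /int01C; under eq_fun do rewrite fourier0.
  under [X in (_ +i* int01 X)%C]eq_fun do rewrite fourier0.
  by rewrite !int01_cst.
have k0 : (m%:~R * (2 * pi) : R) != 0.
  by rewrite mulf_neq0 ?intr_eq0// mulf_neq0 ?pnatr_eq0// gt_eqF ?pi_gt0.
set k := m%:~R * (2 * pi) in k0.
have e1 : (fun x => complex.Re (fourier m x)) = (fun x : R => cos (k * x)).
  by apply: funext => x /=; rewrite mulrA.
have e2 : (fun x => complex.Im (fourier m x)) = (fun x : R => sin (k * x)).
  by apply: funext => x /=; rewrite mulrA.
have [] := fourier_continuous R m; rewrite /int01C e1 e2 => c1 c2.
have dlin (x : R) : is_derive x (1 : R) (fun x : R => k * x) k.
  by apply: is_derive_eq; rewrite ?scaler0 ?add0r /GRing.scale /= mulr1.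
have -> : int01 (fun x => cos (k * x)) = k^-1 * sin (k * 1) - k^-1 * sin (k * 0).
  apply: (@int01_FTC _ _ (fun x => k^-1 * sin (k * x)) c1) => x.
  have ds : is_derive x (1 : R) (fun x => sin (k * x)) (cos (k * x) * k).
    exact: (@is_derive1_comp _ sin (fun x => k * x)).
  by apply: is_derive_eq; rewrite /GRing.scale /= ?mulr0 ?add0r; field.
have -> : int01 (fun x => sin (k * x)) =
    - k^-1 * cos (k * 1) - (- k^-1 * cos (k * 0)).
  apply: (@int01_FTC _ _ (fun x => - k^-1 * cos (k * x)) c2) => x.
  have dc : is_derive x (1 : R) (fun x => cos (k * x)) (- sin (k * x) * k).
    exact: (@is_derive1_comp _ cos (fun x => k * x)).
  by apply: is_derive_eq; rewrite /GRing.scale /= ?mulr0 ?add0r; field.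
by rewrite !mulr1 !mulr0 /k sin2pi_int cos2pi_int sin0 cos0 !subrr.
Qed.

Lemma int01_quadratic (R : realType) (a b c : R) :
  int01 (fun t => a + b * t + c * (t * t)) = a + b / 2 + c / 3.
Proof.
have -> : a + b / 2 + c / 3 = (a * 1 + b / 2 * (1 * 1) + c / 3 * (1 * 1 * 1)) -
   (a * 0 + b / 2 * (0 * 0) + c / 3 * (0 * 0 * 0)) by field.
apply: (@int01_FTC _ _ (fun t => a * t + b / 2 * (t * t) + c / 3 * (t * t * t))).
  move=> t; apply: (@continuousD _ _ _ (fun t => a + b * t)).
    by apply: (@continuousD _ _ _ (fun=> a)); [exact: cvg_cst|exact: continuous_scale].
  apply: continuousM; first exact: cvg_cst.
  by apply: continuousM; exact: cvg_id.
by move=> t; apply: is_derive_eq; rewrite /GRing.scale /=; field.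
Qed.

(** * Second moments of the Haar measure *)

(** The real amplitude of the entry (b, x) of [haarU]. It carries the minus sign of the upper right
    entry, so that what remains is a pure product of characters. *)
Definition haar_amp (R : realType) (b x : bool) (t : R) : R :=
  if b then (if x then Num.sqrt (1 - t) else Num.sqrt t)
  else (if x then - Num.sqrt t else Num.sqrt (1 - t)).

(* Exponents of e(a), e(b) and e(p) in the entry (b, x) of [haarU]. *)
Definition haar_dega (b x : bool) : int :=
  if b then (if x then -1 else 0) else (if x then 0 else 1).
Definition haar_degb (b x : bool) : int :=
  if b then (if x then 0 else 1) else (if x then -1 else 0).
Definition haar_degp (b x : bool) : int := if x then 1 else 0.

Lemma expi_fourier (R : realType) (x : R) : expi x = fourier 1 x.
Proof. by rewrite /expi /fourier mul1r. Qed.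

Lemma haarU_entry (R : realType) (th : 'I_4 -> R) (b x : bool) :
  haarU th (b2o b) (b2o x) = (haar_amp b x (th 0))%:C%C *
    fourier (haar_dega b x) (th 1) * fourier (haar_degb b x) (th 2) *
    fourier (haar_degp b x) (th 3).
Proof.
rewrite /haarU mxE !expi_fourier !conj_fourier.
case: b; case: x; rewrite /= ?fourier0 ?mulr1 ?rmorphN/=; ring.
Qed.

Lemma conj_realC (R : realType) (a : R) : Num.conj (a%:C%C) = a%:C%C :> R[i].
Proof. by apply/eqP; rewrite eq_complex /= oppr0 !eqxx. Qed.

Lemma haarU_pair (R : realType) (th : 'I_4 -> R) (b x x' : bool) :
  haarU th (b2o b) (b2o x) * Num.conj (haarU th (b2o b) (b2o x')) =
  (haar_amp b x (th 0) * haar_amp b x' (th 0))%:C%C *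
    fourier (haar_dega b x - haar_dega b x') (th 1) *
    fourier (haar_degb b x - haar_degb b x') (th 2) *
    fourier (haar_degp b x - haar_degp b x') (th 3).
Proof.
rewrite !haarU_entry !rmorphM/= !conj_fourier conj_realC -!fourierD; ring.
Qed.

(** Orthonormality of the columns. For distinct columns the two rows contribute the same phase with
    opposite amplitudes; for equal columns the phases disappear and 1 - t adds to t. *)
Lemma haarU_unitary (R : realType) (th : 'I_4 -> R) (x x' : bool) :
  0 <= th 0 <= 1 ->
  \sum_(b : bool) haarU th (b2o b) (b2o x) * Num.conj (haarU th (b2o b) (b2o x'))
  = (x == x')%:R.
Proof.
move=> /andP[t0 t1]; rewrite big_bool !haarU_pair.
have s1 : Num.sqrt (th 0) * Num.sqrt (th 0) = th 0 by rewrite -expr2 sqr_sqrtr.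
have s2 : Num.sqrt (1 - th 0) * Num.sqrt (1 - th 0) = 1 - th 0.
  by rewrite -expr2 sqr_sqrtr ?subr_ge0.
case: x; case: x'; rewrite /haar_amp /= ?subrr ?fourier0 ?mulr1 ?mulrNN ?s1 ?s2.
- by rewrite -rmorphD/= subrK.
- by rewrite mulNr rmorphN/= !mulNr [Num.sqrt (1 - _) * _]mulrC subrr.
- by rewrite mulrN rmorphN/= !mulNr [Num.sqrt (1 - _) * _]mulrC subrr.
- by rewrite -rmorphD/= addrC subrK.
Qed.

Lemma continuous_mul (R : realType) (f g : R -> R) :
  continuous f -> continuous g -> continuous (fun x => f x * g x).
Proof. by move=> cf cg x; apply: continuousM; [exact: cf|exact: cg]. Qed.

Lemma haar_amp_continuous (R : realType) (b x : bool) :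
  continuous (@haar_amp R b x).
Proof.
have c1 : continuous (fun t : R => Num.sqrt (1 - t)).
  move=> t; apply: (@continuous_comp _ _ _ (fun t : R => 1 - t)).
    by apply: continuousB; [exact: cvg_cst|exact: cvg_id].
  exact: sqrt_continuous.
have c2 : continuous (fun t : R => Num.sqrt t) by move=> t; exact: sqrt_continuous.
by case: b; case: x => // t; apply: continuousN; exact: c2.
Qed.

Lemma niceC_haarU (R : realType) (I : eqType) (q : 'I_4 -> I) (b x : bool) :
  niceC (fun th : I -> R => haarU (fun r => th (q r)) (b2o b) (b2o x)).
Proof.
under eq_fun do rewrite haarU_entry.
do 3![apply: niceC_mul; last exact/niceC_coord/fourier_continuous].
by apply: niceC_real; apply: (nice_coord (q 0)); exact: haar_amp_continuous.
Qed.

(** The squared amplitude is 1 - t on the diagonal and t off it, but only for t in [0, 1], whence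
    the comparison of integrals in both directions. *)
Lemma int01_haar_amp (R : realType) (b x y : bool) :
  int01 (fun t : R => haar_amp b x t ^+ 2 * haar_amp b y t ^+ 2) =
  if x == y then 1 / 3 else 1 / 6.
Proof.
pose w (z : bool) (t : R) := if z then 1 - t else t.
have cw z : continuous (w z).
  rewrite /w; case: z => t; last exact: cvg_id.
  by apply: continuousB; [exact: cvg_cst|exact: cvg_id].
transitivity (int01 (fun t => w (b == x) t * w (b == y) t)).
  have ampw z t : 0 <= t <= 1 -> haar_amp b z t ^+ 2 = w (b == z) t.
    move=> /andP[t0 t1]; rewrite /haar_amp /w.
    by case: b; case: z; rewrite /= ?sqrrN sqr_sqrtr// subr_ge0.
  have ca : continuous (fun t : R => haar_amp b x t ^+ 2 * haar_amp b y t ^+ 2).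
    under eq_fun do rewrite !expr2.
    by do !apply: continuous_mul; exact: haar_amp_continuous.
  have cww : continuous (fun t : R => w (b == x) t * w (b == y) t).
    by apply: continuous_mul; exact: cw.
  apply/eqP; rewrite eq_le.
  by apply/andP; split; apply: le_int01 => // t t01; rewrite !ampw.
have q1 : int01 (fun t : R => (1 - t) * (1 - t)) = 1 / 3.
  transitivity (int01 (fun t : R => 1 + (- 2) * t + 1 * (t * t))).
    by congr int01; apply: funext => t; ring.
  by rewrite int01_quadratic; field.
have q2 : int01 (fun t : R => (1 - t) * t) = 1 / 6.
  transitivity (int01 (fun t : R => 0 + 1 * t + (- 1) * (t * t))).
    by congr int01; apply: funext => t; ring.
  by rewrite int01_quadratic; field.
have q3 : int01 (fun t : R => t * t) = 1 / 3.
  transitivity (int01 (fun t : R => 0 + 0 * t + 1 * (t * t))).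
    by congr int01; apply: funext => t; ring.
  by rewrite int01_quadratic; field.
rewrite /w; case: b; case: x; case: y => //=.
- by rewrite -q2; congr int01; apply: funext => t; ring.
- by rewrite -q2; congr int01; apply: funext => t; ring.
Qed.

(** The degree in the phase p is x + y - x' - y' with bits read as integers. It vanishes exactly
    when {x, y} and {x', y'} agree as multisets, and then the other two degrees vanish too. Only the
    identity and the swap pairing survive, and when all four bits coincide both hold, giving 2/3. *)
Lemma haar_moment (R : realType) (I : finType) (q : 'I_4 -> I)
    (V := fun (th : I -> R) b x => haarU (fun r => th (q r)) (b2o b) (b2o x))
    (x x' y y' : bool) : injective q ->
  expectC (fun th => \sum_(b : bool)
    V th b x * Num.conj (V th b x') * (V th b y * Num.conj (V th b y'))) =
  3^-1 * (((x == x') && (y == y'))%:R + ((x == y') && (y == x'))%:R).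
Proof.
move=> qi; rewrite expectC_sum; last first.
  by move=> b _; do !apply: niceC_mul; try apply: niceC_conj; exact: niceC_haarU.
pose amp4 b (t : R) :=
  haar_amp b x t * haar_amp b x' t * (haar_amp b y t * haar_amp b y' t).
pose deg (d : bool -> bool -> int) b := d b x - d b x' + (d b y - d b y').
pose g b (k : 'I_4) : R -> R[i] := nth (fun=> 0)
  [:: (fun t => (amp4 b t)%:C%C); fourier (deg haar_dega b);
      fourier (deg haar_degb b); fourier (deg haar_degp b)] k.
have camp b : continuous (amp4 b).
  by do !apply: continuous_mul; exact: haar_amp_continuous.
have cg b k : continuousC (g b k).
  case: k => [[|[|[|[|//]]]] lt]; rewrite /g /=; try exact: fourier_continuous.
  by split => //= t; exact: cvg_cst.
have e b : expectC (fun th => V th b x * Num.conj (V th b x') *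
    (V th b y * Num.conj (V th b y'))) = (int01 (amp4 b))%:C%C *
   ((deg haar_dega b == 0) && (deg haar_degb b == 0) && (deg haar_degp b == 0))%:R.
  rewrite -[RHS]mulr1 -!mulnb !natrM -!int01C_fourier.
  have -> : (int01 (amp4 b))%:C%C = int01C (g b 0).
    by rewrite /int01C /= int01_cst.
  have ur : uniq [:: 0; 1; 2; 3 : 'I_4] by rewrite /=.
  have := expectC_coords ur qi (cg b).
  rewrite !big_cons !big_nil !mulr1 !mulrA => <-; congr expectC; apply: funext => th.
  rewrite !big_cons big_nil /V !haarU_pair /g /= /deg -!fourierD /amp4 !rmorphM/=.
  ring.
rewrite big_bool !e.
have ie b u v : amp4 b = (fun t => haar_amp b u t ^+ 2 * haar_amp b v t ^+ 2) ->
    (int01 (amp4 b))%:C%C = ((if u == v then 1 / 3 else 1 / 6) : R)%:C%C.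
  by move=> ->; rewrite int01_haar_amp.
have c3 : ((1 / 3 : R)%:C)%C = 3^-1 :> R[i] by rewrite div1r fmorphV/= rmorph_nat.
have c6 : ((1 / 6 : R)%:C)%C = 6^-1 :> R[i] by rewrite div1r fmorphV/= rmorph_nat.
have h6 : 6^-1 + 6^-1 = 3^-1 :> R[i].
  by rewrite -c3 -c6 -rmorphD /=; congr (_%:C)%C; field.
rewrite /deg.
case: x x' y y' @amp4 @deg @g camp cg e ie => [] [] [] [] amp4 deg g camp cg e ie;
  rewrite /= ?mulr0 ?addr0 ?mulr1.
all: rewrite ?add0r ?mulr0 ?mulr1 //.
(* Six of the sixteen bit patterns are left, those of degree zero. In each the four amplitudes group
   into the squares of two of them, in columns [u] and [v]. *)
all: have k u v : (forall b t, amp4 b t = haar_amp b u t ^+ 2 * haar_amp b v t ^+ 2) ->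
    forall b, (int01 (amp4 b))%:C%C = if u == v then 3^-1 else 6^-1
  by move=> h b; rewrite (ie b u v) -?c3 -?c6; [case: (u == v)|exact/funext/h].
- rewrite !(k true true) /=; [ring|..]; by move=> b t; rewrite /amp4; ring.
- rewrite !(k true false) /=; [by rewrite h6|..]; by move=> b t; rewrite /amp4; ring.
- rewrite !(k true false) /=; [by rewrite h6|..]; by move=> b t; rewrite /amp4; ring.
- rewrite !(k true false) /=; [by rewrite h6|..]; by move=> b t; rewrite /amp4; ring.
- rewrite !(k true false) /=; [by rewrite h6|..]; by move=> b t; rewrite /amp4; ring.
- rewrite !(k false false) /=; [ring|..]; by move=> b t; rewrite /amp4; ring.
Qed.

(** * Collision probability and purities *)

(** Cuts every string along [A]. This turns a free sum over strings into the representatives, zero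
    on one side of the cut, that index [rdm] and [purity]. *)
Lemma sum_mixb (V : nmodType) (n : nat) (A : {set 'I_n}) (F : bits n -> V) :
  \sum_(v : bits n) F v =
  \sum_(x : bits n | zero_on (~: A) x) \sum_(z : bits n | zero_on A z) F (mixb A x z).
Proof.
pose o : bits n := [ffun=> false].
rewrite pair_big_dep /= (reindex_onto (fun p : bits n * bits n => mixb A p.1 p.2)
  (fun v => (mixb A v o, mixb A o v))) /=; last first.
  by move=> v _; apply/ffunP => i; rewrite !ffunE /=; case: (i \in A).
apply: eq_bigl => -[x z] /=; rewrite xpair_eqE /zero_on; congr (_ && _).
  apply/eqP/forallP => [<- i|h].
    by apply/implyP; rewrite inE => /negbTE iA; rewrite !ffunE iA.
  apply/ffunP => i; rewrite !ffunE; have := h i; rewrite inE.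
  by case: (i \in A) => //= /eqP ->.
apply/eqP/forallP => [<- i|h].
  by apply/implyP => iA; rewrite !ffunE iA.
apply/ffunP => i; rewrite !ffunE; have := h i.
by case: (i \in A) => //= /eqP ->.
Qed.

Definition agree_off (n : nat) (S : {set 'I_n}) (v w : bits n) : bool :=
  [forall i in ~: S, v i == w i].

(** The expectation, in two copies of the state, of the operator exchanging the qubits of [A]
    between the copies. *)
Definition swap_overlap (R : realType) (n : nat) (psi : bits n -> R[i])
    (A : {set 'I_n}) : R[i] :=
  \sum_(v : bits n) \sum_(u : bits n)
    psi v * Num.conj (psi (mixb A u v)) * (psi u * Num.conj (psi (mixb A v u))).

Lemma sqnormE (R : realType) (z : R[i]) : (sqnorm z)%:C%C = z * Num.conj z.
Proof.
case: z => a b; rewrite /sqnorm; apply/eqP; rewrite eq_complex /=.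
by apply/andP; split; apply/eqP; ring.
Qed.

Lemma normalizedC (R : realType) (n : nat) (psi : bits n -> R[i]) :
  normalized psi -> \sum_(v : bits n) psi v * Num.conj (psi v) = 1.
Proof.
move=> psi1; rewrite -[RHS](rmorph1 (real_complex R)) -psi1 rmorph_sum /=.
by apply: eq_bigr => v _; rewrite sqnormE.
Qed.

Lemma mixbT0 (n : nat) (u v : bits n) : mixb finset.set0 u v = v.
Proof. by apply/ffunP => i; rewrite ffunE inE. Qed.

Lemma mixb_mixb (n : nat) (A : {set 'I_n}) (x y z z' : bits n) :
  mixb A (mixb A x z) (mixb A y z') = mixb A x z'.
Proof. by apply/ffunP => i; rewrite !ffunE; case: (i \in A). Qed.

(** The swap trick. Writing v = (x, z) and u = (y, z') along [A], the sum over z yields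
    [rdm psi A x y] and the sum over z' yields [rdm psi A y x]. For empty [A] the overlap is the
    squared norm times itself, matching the convention that this purity is 1. *)
Lemma purityE (R : realType) (n : nat) (psi : bits n -> R[i]) (A : {set 'I_n}) :
  normalized psi -> purity psi A = complex.Re (swap_overlap psi A).
Proof.
move=> psi1; rewrite /purity; case: eqP => [->|_].
  rewrite /swap_overlap; under eq_bigr do under eq_bigr do rewrite !mixbT0.
  under eq_bigr do rewrite -big_distrr /=.
  by rewrite -big_distrl /= normalizedC// mul1r.
congr complex.Re; rewrite /swap_overlap (sum_mixb A).
apply: eq_bigr => x _; rewrite exchange_big /=.
rewrite (sum_mixb A); apply: eq_bigr => y _.
rewrite /rdm big_distrlr exchange_big /=.
apply: eq_bigr => z' _; apply: eq_bigr => z _.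
by rewrite !mixb_mixb; ring.
Qed.

Definition overwrite (n : nat) (S : {set 'I_n}) (z : outcome S) (v : bits n) : bits n :=
  [ffun i => oapp z (v i) (insub i)].

Lemma overwriteP (n : nat) (S : {set 'I_n}) (z : outcome S) (v w : bits n) :
  [forall j : qS S, w (val j) == z j] && agree_off S v w = (w == overwrite z v).
Proof.
apply/andP/eqP => [[/forallP wz /forallP vw]|->].
  apply/ffunP => i; rewrite ffunE; case: insubP => [j _ <-|iS] /=.
    exact/eqP/wz.
  by have := vw i; rewrite inE iS => /eqP.
split; apply/forallP => i; first by rewrite ffunE valK /=.
by rewrite inE; apply/implyP => iS; rewrite ffunE insubN.
Qed.

Lemma agree_off_overwrite (n : nat) (S : {set 'I_n}) (z : outcome S) (v w : bits n) :
  agree_off S w (overwrite z v) = agree_off S w v.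
Proof.
apply: eq_forallb => i; rewrite inE; case: (boolP (i \in S)) => //= iS.
by rewrite ffunE insubN.
Qed.

(** In the expanded square, the measured string [w] equals [z] on [S] and [v] off [S], so it is
    [overwrite z v] and its sum collapses. What is left is a product over qubits of an entry times a
    conjugate entry in the same row, the shape that [haar_moment] averages. *)
Lemma meas_probE (R : realType) (n : nat) (S : {set 'I_n})
    (V : qS S -> 'M[R[i]]_2) (psi : bits n -> R[i]) (z : outcome S) :
  (meas_prob V psi z)%:C%C = \sum_(v : bits n) \sum_(v' : bits n | agree_off S v' v)
    (\prod_(j : qS S) (V j (b2o (z j)) (b2o (v (val j))) *
                       Num.conj (V j (b2o (z j)) (b2o (v' (val j)))))) *
    (psi v * Num.conj (psi v')).
Proof.
rewrite /meas_prob rmorph_sum /=.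
transitivity (\sum_(w : bits n | [forall j : qS S, w (val j) == z j])
    \sum_(v | agree_off S v w) \sum_(v' | agree_off S v' w)
    (\prod_(j : qS S) (V j (b2o (z j)) (b2o (v (val j))) *
                       Num.conj (V j (b2o (z j)) (b2o (v' (val j)))))) *
    (psi v * Num.conj (psi v'))).
  apply: eq_bigr => w /forallP wz; rewrite sqnormE /apply_local rmorph_sum /=.
  rewrite big_distrlr /=; apply: eq_bigr => v _; apply: eq_bigr => v' _.
  rewrite rmorphM rmorph_prod /= mulrACA -big_split /=.
  by congr (_ * _); apply: eq_bigr => j _; rewrite (eqP (wz j)).
rewrite (exchange_big_dep predT) //=; apply: eq_bigr => v _.
rewrite (big_pred1 (overwrite z v)) => [|w]; last exact: overwriteP.
by apply: eq_bigl => v'; rewrite agree_off_overwrite.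
Qed.

Lemma sum_outcomes (R : realType) (n : nat) (S : {set 'I_n})
    (F : qS S -> bool -> R[i]) :
  \sum_(z : outcome S) \prod_(j : qS S) F j (z j) =
  \prod_(j : qS S) \sum_(b : bool) F j b.
Proof. by rewrite bigA_distr_bigA. Qed.

Lemma agree_off_eq (n : nat) (S : {set 'I_n}) (v w : bits n) :
  agree_off S v w -> (forall j : qS S, v (val j) = w (val j)) -> v = w.
Proof.
move=> /forallP vw e; apply/ffunP => i; have [iS|iS] := boolP (i \in S).
  exact: (e (exist _ i iS)).
by have := vw i; rewrite inE iS => /eqP.
Qed.

(** Summing over outcomes sums each qubit over its rows; orthonormal columns then force v' = v on
    [S], and v' already agrees with v elsewhere. *)
Lemma sum_meas_prob (R : realType) (n : nat) (S : {set 'I_n})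
    (V : qS S -> 'M[R[i]]_2) (psi : bits n -> R[i]) :
  (forall j x x', \sum_(b : bool) V j (b2o b) (b2o x) *
     Num.conj (V j (b2o b) (b2o x')) = (x == x')%:R) ->
  normalized psi -> \sum_(z : outcome S) meas_prob V psi z = 1.
Proof.
move=> Vu psi1; apply: (@complexI R); rewrite rmorph_sum rmorph1 /=.
under eq_bigr do rewrite meas_probE.
rewrite exchange_big -[RHS](normalizedC psi1) /=; apply: eq_bigr => v _.
rewrite exchange_big /= (bigD1 v) /=; last by apply/forallP => i; rewrite eqxx implybT.
rewrite -big_distrl /= (sum_outcomes (fun j b => V j (b2o b) (b2o (v (val j))) *
  Num.conj (V j (b2o b) (b2o (v (val j)))))) /=.
rewrite big1 ?mul1r => [|j _]; last by rewrite Vu eqxx.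
rewrite big1 ?addr0 // => v' /andP[v'v ne]; rewrite -big_distrl /=.
rewrite (sum_outcomes (fun j b => V j (b2o b) (b2o (v (val j))) *
  Num.conj (V j (b2o b) (b2o (v' (val j)))))) /=.
have [j vj] : exists j : qS S, v (val j) != v' (val j).
  apply/existsP; apply: contraNT ne; rewrite negb_exists => /forallP h.
  apply/eqP; apply: agree_off_eq v'v _ => j; apply/esym/eqP.
  by have := h j; rewrite negbK.
by rewrite (bigD1 j) //= Vu (negbTE vj) !mul0r.
Qed.

(* Per qubit, the Haar average leaves the identity pairing or the swapped one;
   choosing the set [J] of swapped qubits expands the product. *)
Lemma prod_pairings (R : realType) (n : nat) (S : {set 'I_n}) (v v' u u' : bits n) :
  agree_off S v' v -> agree_off S u' u ->
  \prod_(i in S) (((v i == v' i) && (u i == u' i))%:R +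
                  ((v i == u' i) && (u i == v' i))%:R) =
  \sum_(J : {set 'I_n} | J \subset S)
    ((v' == mixb J u v) && (u' == mixb J v u))%:R :> R[i].
Proof.
move=> /forallP av /forallP au.
(* The product is extended to all qubits: off [S], [G] is 1 by the two agreement hypotheses, while
   [F] is 0 and so removes every [J] not inside [S]. *)
pose F i : R[i] := if i \in S then ((v i == u' i) && (u i == v' i))%:R else 0.
pose G i : R[i] := ((v i == v' i) && (u i == u' i))%:R.
transitivity (\prod_i (F i + G i)).
  rewrite [RHS](bigID [in S]) /= [X in _ = _ * X]big1 ?mulr1 => [|i iS].
    by apply: eq_bigr => i iS; rewrite /F iS addrC.
  rewrite /F (negbTE iS) add0r /G.
  by have := av i; have := au i; rewrite inE iS /= => /eqP -> /eqP ->; rewrite !eqxx.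
rewrite bigA_distr (bigID (fun J : {set 'I_n} => J \subset S)) /=.
rewrite [X in _ + X]big1 ?addr0 => [|J /fintype.subsetPn[i iJ iS]]; last first.
  by rewrite (bigD1 i) //= iJ /F (negbTE iS) mul0r.
apply: eq_bigr => J /fintype.subsetP JS.
transitivity (\prod_i ((v' i == mixb J u v i) && (u' i == mixb J v u i))%:R : R[i]).
  apply: eq_bigr => i _; rewrite !ffunE /F /G; case: ifP => [/JS ->|_].
    by rewrite andbC eq_sym [u' i == _]eq_sym.
  by rewrite eq_sym [u' i == _]eq_sym.
have [/andP[/eqP -> /eqP ->]|] := boolP (_ && _).
  by rewrite big1 // => i _; rewrite !eqxx.
move=> h; have [i hi] : exists i, ~~ ((v' i == mixb J u v i) && (u' i == mixb J v u i)).
  apply/existsP; apply: contraNT h; rewrite negb_exists => /forallP h.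
  by apply/andP; split; apply/eqP/ffunP => i; have := h i;
    rewrite negbK => /andP[/eqP ? /eqP ?].
by rewrite (bigD1 i) //= (negbTE hi) mul0r.
Qed.

Lemma agree_off_mixb (n : nat) (S J : {set 'I_n}) (u v : bits n) :
  J \subset S -> agree_off S (mixb J u v) v.
Proof.
move=> /fintype.subsetP JS; apply/forallP => i; rewrite inE; apply/implyP => iS.
by rewrite ffunE; case: ifP => [/JS|//]; rewrite (negbTE iS).
Qed.

Lemma sum_pairings (R : realType) (n : nat) (S : {set 'I_n}) (psi : bits n -> R[i]) :
  \sum_(v : bits n) \sum_(v' : bits n | agree_off S v' v)
  \sum_(u : bits n) \sum_(u' : bits n | agree_off S u' u)
    (\prod_(i in S) (((v i == v' i) && (u i == u' i))%:R +
                  ((v i == u' i) && (u i == v' i))%:R)) *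
    (psi v * Num.conj (psi v') * (psi u * Num.conj (psi u'))) =
  \sum_(J : {set 'I_n} | J \subset S) swap_overlap psi J.
Proof.
rewrite /swap_overlap exchange_big; apply: eq_bigr => v _ /=.
rewrite exchange_big /= [RHS]exchange_big /=; apply: eq_bigr => u _.
transitivity (\sum_(v' | agree_off S v' v) \sum_(u' | agree_off S u' u)
   \sum_(J : {set 'I_n} | J \subset S)
    ((v' == mixb J u v) && (u' == mixb J v u))%:R *
    (psi v * Num.conj (psi v') * (psi u * Num.conj (psi u')))).
  apply: eq_bigr => v' av; apply: eq_bigr => u' au.
  by rewrite prod_pairings// big_distrl.
under [LHS]eq_bigr => v' av do rewrite exchange_big /=.
rewrite exchange_big /=; apply: eq_bigr => J JS.
(* For fixed [J] the pair (v', u') is forced, and it meets the agreement constraints because [J]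
   lies in [S]. *)
rewrite (bigD1 (mixb J u v)) ?agree_off_mixb//= (bigD1 (mixb J v u)) ?agree_off_mixb//=.
rewrite !eqxx mul1r big1 => [|u' /andP[_ /negbTE ->]]; last by rewrite andbF mul0r.
rewrite big1 ?addr0// => v' /andP[_ /negbTE ->].
by rewrite big1// => u' _; rewrite mul0r.
Qed.

Lemma expectCZ (R : realType) (I : finType) (c : R[i]) (f : (I -> R) -> R[i]) :
  niceC f -> expectC (fun th => f th * c) = expectC f * c.
Proof.
move=> nf; rewrite (expectC_indep (A := predT) (B := pred0))//.
- by rewrite expectC_cst.
- exact: niceC_cst.
- by move=> th th' e; congr f; apply: funext => i; exact: e.
Qed.

Lemma nice_meas_prob (R : realType) (I : eqType) (n : nat) (S : {set 'I_n})
    (q : qS S -> 'I_4 -> I) (psi : bits n -> R[i]) (z : outcome S) :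
  nice (fun th : I -> R => meas_prob (fun j => haarU (fun r => th (q j r))) psi z).
Proof.
have [] // : niceC (fun th : I -> R =>
    (meas_prob (fun j => haarU (fun r => th (q j r))) psi z)%:C%C).
under eq_fun do rewrite meas_probE.
apply: niceC_sum => v _; apply: niceC_sum => v' _; apply: niceC_mul.
  apply: niceC_prod => j _; apply: niceC_mul; last apply: niceC_conj;
    exact: niceC_haarU.
exact: niceC_cst.
Qed.

(** The labelling [q] is abstract because a round reads only its own slice of the parameters of all
    rounds. Its injectivity makes the qubits independent of each other, and likewise the four
    parameters of one qubit. *)
Lemma expect_collision (R : realType) (I : finType) (n : nat) (S : {set 'I_n})
    (q : qS S -> 'I_4 -> I) (psi : bits n -> R[i]) :
  (forall j j' r r', q j r = q j' r' -> j = j' /\ r = r') -> normalized psi ->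
  expect (fun th : I -> R => \sum_(z : outcome S)
    meas_prob (fun j => haarU (fun r => th (q j r))) psi z ^+ 2) =
  3^-1 ^+ #|S| * \sum_(alpha : {set 'I_n} | alpha \subset S) purity psi alpha.
Proof.
move=> qi psi1.
pose M (th : I -> R) (j : qS S) (b x x' : bool) :=
  haarU (fun r => th (q j r)) (b2o b) (b2o x) *
  Num.conj (haarU (fun r => th (q j r)) (b2o b) (b2o x')).
pose D (v v' u u' : bits n) (i : 'I_n) : R[i] :=
  ((v i == v' i) && (u i == u' i))%:R + ((v i == u' i) && (u i == v' i))%:R.
pose c (v v' u u' : bits n) :=
  psi v * Num.conj (psi v') * (psi u * Num.conj (psi u')).
have nM j b x x' : niceC (fun th => M th j b x x').
  by apply: niceC_mul; last apply: niceC_conj; exact: niceC_haarU.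
pose Q (v v' u u' : bits n) (j : qS S) (th : I -> R) := \sum_(b : bool)
  M th j b (v (val j)) (v' (val j)) * M th j b (u (val j)) (u' (val j)).
have nQ v v' u u' j : niceC (Q v v' u u' j).
  by apply: niceC_sum => b _; exact: niceC_mul.
have EQ v v' u u' : expectC (fun th => \prod_(j : qS S) Q v v' u u' j th) =
    3^-1 ^+ #|S| * \prod_(i in S) D v v' u u' i.
  rewrite (expectC_prod (A := fun j i => [exists r, i == q j r])) => //.
  - rewrite -prodr_const -big_split /= [RHS]big_sub /=; apply: eq_bigr => j _.
    by rewrite /D -(@haar_moment _ I (q j)) // => r r' /qi[].
  - exact: index_enum_uniq.
  - move=> j th th' e; apply: eq_bigr => b _; congr (_ * _).
      by congr (haarU _ _ _ * Num.conj (haarU _ _ _)); apply: funext => r;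
        apply: e; apply/existsP; exists r.
    by congr (haarU _ _ _ * Num.conj (haarU _ _ _)); apply: funext => r;
      apply: e; apply/existsP; exists r.
  - move=> j j' i jj' /existsP[r /eqP ->]; apply/negP => /existsP[r' /eqP].
    by move=> /qi[/eqP]; rewrite (negbTE jj').
pose P (th : I -> R) (z : outcome S) :=
  meas_prob (fun j => haarU (fun r => th (q j r))) psi z.
(* The squared probability is a fourfold sum over strings. Once the sum over outcomes is moved
   inside, it becomes one sum over the row bit [b] for each qubit. *)
have PE th : (\sum_(z : outcome S) P th z ^+ 2)%:C%C =
    \sum_(v : bits n) \sum_(v' : bits n | agree_off S v' v)
    \sum_(u : bits n) \sum_(u' : bits n | agree_off S u' u)
      (\prod_(j : qS S) Q v v' u u' j th) * c v v' u u'.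
  rewrite rmorph_sum /=.
  transitivity (\sum_(z : outcome S)
    \sum_(v : bits n) \sum_(v' : bits n | agree_off S v' v)
    \sum_(u : bits n) \sum_(u' : bits n | agree_off S u' u)
      (\prod_(j : qS S) (M th j (z j) (v (val j)) (v' (val j)) *
         M th j (z j) (u (val j)) (u' (val j)))) * c v v' u u').
    apply: eq_bigr => z _; rewrite rmorphXn /= expr2 meas_probE.
    rewrite big_distrl /=; apply: eq_bigr => v _.
    rewrite big_distrl /=; apply: eq_bigr => v' _.
    rewrite big_distrr /=; apply: eq_bigr => u _.
    rewrite big_distrr /=; apply: eq_bigr => u' _.
    by rewrite mulrACA [in RHS]big_split.
  rewrite exchange_big /=; apply: eq_bigr => v _.
  rewrite exchange_big /=; apply: eq_bigr => v' _.
  rewrite exchange_big /=; apply: eq_bigr => u _.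
  rewrite exchange_big /=; apply: eq_bigr => u' _.
  rewrite -big_distrl /=; congr (_ * _).
  exact: (sum_outcomes (fun j b => M th j b (v (val j)) (v' (val j)) *
    M th j b (u (val j)) (u' (val j)))).
transitivity (complex.Re (expectC (fun th => (\sum_(z : outcome S) P th z ^+ 2)%:C%C))).
  by rewrite expectC_real.
under eq_fun do rewrite PE.
have nQc v v' u u' : niceC (fun th => (\prod_(j : qS S) Q v v' u u' j th) * c v v' u u').
  by apply: niceC_mul; [exact: niceC_prod|exact: niceC_cst].
transitivity (complex.Re ((3^-1 ^+ #|S|) *
    \sum_(J : {set 'I_n} | J \subset S) swap_overlap psi J)).
  congr complex.Re; rewrite -sum_pairings expectC_sum => [|v _]; last first.
    by do 3![apply: niceC_sum => ? _]; exact: nQc.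
  rewrite big_distrr /=; apply: eq_bigr => v _.
  rewrite expectC_sum => [|v' _]; last by do 2![apply: niceC_sum => ? _]; exact: nQc.
  rewrite big_distrr /=; apply: eq_bigr => v' _.
  rewrite expectC_sum => [|u _]; last by apply: niceC_sum => ? _; exact: nQc.
  rewrite big_distrr /=; apply: eq_bigr => u _.
  rewrite expectC_sum => [|u' _]; last exact: nQc.
  rewrite big_distrr /=; apply: eq_bigr => u' _.
  by rewrite expectCZ ?EQ ?mulrA//; exact: niceC_prod.
have -> : 3^-1 ^+ #|S| = (3^-1 ^+ #|S|)%:C%C :> R[i].
  by rewrite rmorphXn fmorphV /= rmorph_nat.
rewrite complex_ReM /= mul0r mulr0 addr0; congr (_ * _).
rewrite (big_morph (@complex.Re R) (@complex_ReD R) erefl).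
by apply: eq_bigr => J _; rewrite purityE.
Qed.

(** * Independent measurement rounds *)

(** The U-statistic of order 2 with the equality kernel, for one row of outcomes in an arbitrary
    finite set. *)
Definition collision_rate (R : realType) (O : finType) (K : nat)
    (Y : {ffun 'I_K -> O}) : R :=
  (K * (K - 1))%:R^-1 *
    \sum_(k : 'I_K) \sum_(k' : 'I_K | k' != k) (Y k == Y k')%:R.

Definition iid_mean (R : realType) (O : finType) (K : nat) (p : O -> R)
    (h : {ffun 'I_K -> O} -> R) : R :=
  \sum_(Y : {ffun 'I_K -> O}) (\prod_(k : 'I_K) p (Y k)) * h Y.

Definition round_outcomes (T : Type) (L K : nat) (Z : {ffun 'I_L * 'I_K -> T}) (l : 'I_L) :
  {ffun 'I_K -> T} := [ffun k => Z (l, k)].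

Lemma iid_mean_cst (R : realType) (O : finType) (K : nat) (p : O -> R) (c : R) :
  \sum_o p o = 1 -> iid_mean p (fun _ : {ffun 'I_K -> O} => c) = c.
Proof.
move=> p1; rewrite /iid_mean -big_distrl /= -(bigA_distr_bigA (fun _ o => p o)).
by rewrite big1 ?mul1r.
Qed.

Lemma iid_meanD (R : realType) (O : finType) (K : nat) (p : O -> R)
    (g h : {ffun 'I_K -> O} -> R) :
  iid_mean p (fun Y => g Y + h Y) = iid_mean p g + iid_mean p h.
Proof. by rewrite /iid_mean -big_split; apply: eq_bigr => Y _; rewrite mulrDr. Qed.

Lemma iid_meanZ (R : realType) (O : finType) (K : nat) (p : O -> R) (c : R)
    (h : {ffun 'I_K -> O} -> R) :
  iid_mean p (fun Y => c * h Y) = c * iid_mean p h.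
Proof. by rewrite /iid_mean big_distrr; apply: eq_bigr => Y _; rewrite mulrCA. Qed.

Lemma le_iid_mean (R : realType) (O : finType) (K : nat) (p : O -> R)
    (g h : {ffun 'I_K -> O} -> R) :
  (forall o, 0 <= p o) -> (forall Y, g Y <= h Y) -> iid_mean p g <= iid_mean p h.
Proof.
move=> p0 gh; apply: ler_sum => Y _; apply: ler_wpM2l => //.
by apply: prodr_ge0 => k _.
Qed.

(** The event that two draws agree is split by their common value [o]. Each piece is a product of
    one-draw functions, so it factorizes: the draws [a] and [b] give p(o) each, and every other draw
    sums to 1. *)
Lemma iid_mean_collision2 (R : realType) (O : finType) (K : nat) (p : O -> R)
    (a b : 'I_K) : \sum_o p o = 1 -> a != b ->
  iid_mean p (fun Y : {ffun 'I_K -> O} => (Y a == Y b)%:R) = \sum_o p o ^+ 2.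
Proof.
move=> p1 ab; rewrite /iid_mean.
pose f (o : O) (k : 'I_K) (x : O) : R :=
  p x * (if k == a then (x == o)%:R else if k == b then (x == o)%:R else 1).
transitivity (\sum_(Y : {ffun 'I_K -> O}) \sum_o \prod_k f o k (Y k)).
  apply: eq_bigr => Y _; rewrite /f; under [RHS]eq_bigr do rewrite big_split /=.
  rewrite -big_distrr /=; congr (_ * _).
  rewrite (bigD1 (Y a)) //= [X in _ + X]big1 ?addr0 => [|o ho]; last first.
    by rewrite (bigD1 a) //= eqxx eq_sym (negbTE ho) mul0r.
  rewrite (bigD1 a) //= !eqxx mul1r (bigD1 b) //=; last by rewrite eq_sym.
  rewrite eqxx [b == a]eq_sym (negbTE ab) big1 ?mulr1 1?eq_sym // => k /andP[ka kb].
  by rewrite (negbTE ka) (negbTE kb).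
rewrite exchange_big /=; apply: eq_bigr => o _.
rewrite -(bigA_distr_bigA (f o)) (bigD1 a) //= (bigD1 b) /=; last by rewrite eq_sym.
have sf k : (k == a) || (k == b) -> \sum_x f o k x = p o.
  move=> kab; rewrite (bigD1 o) //= big1 ?addr0 => [|x xo]; rewrite /f.
    by move: kab; case: (k == a); case: (k == b) => //= _; rewrite eqxx mulr1.
  by move: kab; rewrite (negbTE xo); case: (k == a); case: (k == b) => //= _;
    rewrite mulr0.
rewrite !sf ?eqxx ?orbT // big1 ?mulr1 // => k /andP[ka kb].
rewrite -p1; apply: eq_bigr => x _.
by rewrite /f (negbTE ka) (negbTE kb) mulr1.
Qed.

Lemma iid_mean_sum (R : realType) (O : finType) (K : nat) (p : O -> R)
    (J : finType) (P : pred J) (h : J -> {ffun 'I_K -> O} -> R) :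
  iid_mean p (fun Y => \sum_(j | P j) h j Y) = \sum_(j | P j) iid_mean p (h j).
Proof.
rewrite /iid_mean exchange_big /=; apply: eq_bigr => Y _.
by rewrite big_distrr.
Qed.

Lemma sum_ordered_pairs (R : realType) (K : nat) (c : R) :
  \sum_(k : 'I_K) \sum_(k' : 'I_K | k' != k) c = (K * (K - 1))%:R * c.
Proof.
rewrite (eq_bigr (fun=> (K - 1)%:R * c)) => [|k _].
  by rewrite sumr_const card_ord -[LHS]mulr_natl mulrA natrM.
rewrite sumr_const [RHS]mulr_natl; congr (_ *+ _).
have := cardC (pred1 k); rewrite card1 card_ord => e.
by rewrite -[in RHS]e add1n subn1 /=; exact: eq_card.
Qed.

Lemma pairs_gt0 (R : realType) (K : nat) : (2 <= K)%N -> 0 < (K * (K - 1))%:R :> R.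
Proof. by case: K => [|[|K]] // _; rewrite ltr0n subn1. Qed.

Lemma iid_mean_collision_rate (R : realType) (O : finType) (K : nat) (p : O -> R) :
  (2 <= K)%N -> \sum_o p o = 1 ->
  iid_mean p (@collision_rate R O K) = \sum_o p o ^+ 2.
Proof.
move=> K2 p1; rewrite /collision_rate iid_meanZ iid_mean_sum.
under eq_bigr do rewrite iid_mean_sum.
rewrite (eq_bigr (fun k => \sum_(k' | k' != k) \sum_o p o ^+ 2)) => [|k _].
  by rewrite sum_ordered_pairs mulrA mulVf ?mul1r // gt_eqF ?pairs_gt0.
by apply: eq_bigr => k' kk'; rewrite iid_mean_collision2 // eq_sym.
Qed.

Lemma collision_rate_01 (R : realType) (O : finType) (K : nat) (Y : {ffun 'I_K -> O}) :
  (2 <= K)%N -> 0 <= collision_rate R Y <= 1.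
Proof.
move=> K2; rewrite /collision_rate; apply/andP; split.
  apply: mulr_ge0; first by rewrite invr_ge0 ltW ?pairs_gt0.
  by apply: sumr_ge0 => k _; apply: sumr_ge0 => k' _; rewrite ler0n.
rewrite mulrC ler_pdivrMr ?pairs_gt0 // mul1r -[leRHS]mulr1 -sum_ordered_pairs.
by apply: ler_sum => k _; apply: ler_sum => k' _; rewrite lern1 leq_b1.
Qed.

(** A table of outcomes is a tuple of rows. This is the independence of the rounds once the
    unitaries are fixed. *)
Lemma sum_rows (R : realType) (O : finType) (L K : nat)
    (G : 'I_L -> {ffun 'I_K -> O} -> R) :
  \sum_(Z : {ffun 'I_L * 'I_K -> O}) \prod_l G l (round_outcomes Z l) =
  \prod_l \sum_(Y : {ffun 'I_K -> O}) G l Y.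
Proof.
rewrite bigA_distr_bigA /=.
rewrite (reindex (fun Z : {ffun 'I_L * 'I_K -> O} => [ffun l => round_outcomes Z l])) /=.
  by apply: eq_bigr => Z _; apply: eq_bigr => l _; rewrite ffunE.
exists (fun W : {ffun 'I_L -> {ffun 'I_K -> O}} => [ffun lk => W lk.1 lk.2]).
  by move=> Z _; apply/ffunP => -[l k]; rewrite !ffunE.
by move=> W _; apply/ffunP => l; apply/ffunP => k; rewrite !ffunE.
Qed.

Lemma outcomes_weightE (R : realType) (n : nat) (psi : bits n -> R[i])
    (S : {set 'I_n}) (L K : nat) (th : params S L -> R)
    (Z : {ffun 'I_L * 'I_K -> outcome S}) :
  outcomes_weight psi th Z =
  \prod_l \prod_k meas_prob (locU th l) psi (round_outcomes Z l k).
Proof.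
rewrite /outcomes_weight pair_big /=; apply: eq_bigr => -[l k] _.
by rewrite ffunE.
Qed.

Lemma ShatE (R : realType) (n : nat) (S : {set 'I_n}) (L K : nat)
    (Z : {ffun 'I_L * 'I_K -> outcome S}) (l : 'I_L) :
  Shat R Z l = collision_rate R (round_outcomes Z l).
Proof.
rewrite /Shat /collision_rate; congr (_ * _); apply: eq_bigr => k _.
by apply: eq_bigr => k' _; rewrite !ffunE.
Qed.

Lemma sum_weight_prod (R : realType) (n : nat) (psi : bits n -> R[i])
    (S : {set 'I_n}) (L K : nat) (th : params S L -> R)
    (h : 'I_L -> {ffun 'I_K -> outcome S} -> R) :
  \sum_(Z : {ffun 'I_L * 'I_K -> outcome S})
    outcomes_weight psi th Z * \prod_l h l (round_outcomes Z l) =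
  \prod_l iid_mean (meas_prob (locU th l) psi) (h l).
Proof.
rewrite -sum_rows; apply: eq_bigr => Z _.
by rewrite outcomes_weightE -big_split.
Qed.

Lemma meas_prob_ge0 (R : realType) (n : nat) (S : {set 'I_n})
    (V : qS S -> 'M[R[i]]_2) (psi : bits n -> R[i]) (z : outcome S) :
  0 <= meas_prob V psi z.
Proof. by apply: sumr_ge0 => w _; apply: addr_ge0; exact: sqr_ge0. Qed.

Lemma sum_meas_prob_locU (R : realType) (n : nat) (psi : bits n -> R[i])
    (S : {set 'I_n}) (L : nat) (th : params S L -> R) (l : 'I_L) :
  normalized psi -> unit_cube th -> \sum_z meas_prob (locU th l) psi z = 1.
Proof.
move=> psi1 cth; apply: sum_meas_prob => // j x x'.
exact: haarU_unitary.
Qed.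

Lemma sum_weight_rate (R : realType) (n : nat) (psi : bits n -> R[i])
    (S : {set 'I_n}) (L K : nat) (th : params S L -> R) (l : 'I_L) :
  (2 <= K)%N -> normalized psi -> unit_cube th ->
  \sum_(Z : {ffun 'I_L * 'I_K -> outcome S})
    outcomes_weight psi th Z * collision_rate R (round_outcomes Z l) =
  \sum_z meas_prob (locU th l) psi z ^+ 2.
Proof.
move=> K2 psi1 cth.
have s1 l' := sum_meas_prob_locU l' psi1 cth.
rewrite -(iid_mean_collision_rate K2 (s1 l)).
(* The other rounds get the factor 1, so that the integrand is a product over rounds and each of
   them contributes its total mass 1. *)
transitivity (\sum_(Z : {ffun 'I_L * 'I_K -> outcome S}) outcomes_weight psi th Z *
    \prod_l' (if l' == l then collision_rate R (round_outcomes Z l') else 1)).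
  apply: eq_bigr => Z _; congr (_ * _).
  by rewrite (bigD1 l) //= eqxx big1 ?mulr1 // => l' /negbTE ->.
rewrite (sum_weight_prod psi th
  (fun l' Y => if l' == l then collision_rate R Y else 1)).
rewrite (bigD1 l) //= eqxx big1 ?mulr1 // => l' /negbTE ->.
by rewrite iid_mean_cst.
Qed.

Lemma sum_weight (R : realType) (n : nat) (psi : bits n -> R[i])
    (S : {set 'I_n}) (L K : nat) (th : params S L -> R) :
  normalized psi -> unit_cube th ->
  \sum_(Z : {ffun 'I_L * 'I_K -> outcome S}) outcomes_weight psi th Z = 1.
Proof.
move=> psi1 cth.
transitivity (\sum_(Z : {ffun 'I_L * 'I_K -> outcome S}) outcomes_weight psi th Z *
    \prod_(l < L) 1).
  by apply: eq_bigr => Z _; rewrite big1 ?mulr1.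
rewrite (sum_weight_prod psi th (fun=> fun=> 1)) big1 // => l _.
by rewrite iid_mean_cst // sum_meas_prob_locU.
Qed.

(** * The mean of a round and unbiasedness *)

Lemma nice_meas_prob_locU (R : realType) (n : nat) (psi : bits n -> R[i])
    (S : {set 'I_n}) (L : nat) (l : 'I_L) (z : outcome S) :
  nice (fun th : params S L -> R => meas_prob (locU th l) psi z).
Proof. exact: (nice_meas_prob (fun j r => (l, j, r))). Qed.

Lemma nice_weight (R : realType) (n : nat) (psi : bits n -> R[i])
    (S : {set 'I_n}) (L K : nat) (F : {ffun 'I_L * 'I_K -> outcome S} -> R) :
  nice (fun th : params S L -> R => \sum_Z outcomes_weight psi th Z * F Z).
Proof.
apply: nice_sum => Z _; apply: nice_mul; last exact: nice_cst.
by apply: nice_prod => lk _; exact: nice_meas_prob_locU.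
Qed.

Lemma nice_iid_mean (R : realType) (n : nat) (psi : bits n -> R[i])
    (S : {set 'I_n}) (L K : nat) (l : 'I_L) (h : {ffun 'I_K -> outcome S} -> R) :
  nice (fun th : params S L -> R => iid_mean (meas_prob (locU th l) psi) h).
Proof.
apply: nice_sum => Y _; apply: nice_mul; last exact: nice_cst.
by apply: nice_prod => k _; exact: nice_meas_prob_locU.
Qed.

(** The Haar-averaged collision probability, hence the common mean of all the [Shat R Z l]. *)
Definition mean_purity (R : realType) (n : nat) (psi : bits n -> R[i])
    (S : {set 'I_n}) : R :=
  3^-1 ^+ #|S| * \sum_(alpha : {set 'I_n} | alpha \subset S) purity psi alpha.

Lemma concentratable_entanglementE (R : realType) (n : nat) (psi : bits n -> R[i])
    (S : {set 'I_n}) :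
  concentratable_entanglement psi S = 1 - (3 / 2) ^+ #|S| * mean_purity psi S.
Proof.
rewrite /concentratable_entanglement /mean_purity mulrA -exprMn -exprVn.
by congr (1 - _ ^+ _ * _); field.
Qed.

Lemma expect_collision_locU (R : realType) (n : nat) (psi : bits n -> R[i])
    (S : {set 'I_n}) (L : nat) (l : 'I_L) : normalized psi ->
  expect (fun th : params S L -> R => \sum_z meas_prob (locU th l) psi z ^+ 2) =
  mean_purity psi S.
Proof.
move=> psi1; apply: (expect_collision (q := fun j r => (l, j, r))) => //.
by move=> j j' r r' [].
Qed.

Lemma nice_sqr (R : realType) (I : eqType) (f : (I -> R) -> R) :
  nice f -> nice (fun th => f th ^+ 2).
Proof.
move=> nf; have -> : (fun th => f th ^+ 2) = (fun th => f th * f th).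
  by apply: funext => th; rewrite expr2.
exact: nice_mul.
Qed.

Lemma nice_collision (R : realType) (n : nat) (psi : bits n -> R[i])
    (S : {set 'I_n}) (L : nat) (l : 'I_L) :
  nice (fun th : params S L -> R => \sum_z meas_prob (locU th l) psi z ^+ 2).
Proof.
by apply: nice_sum => z _; apply: nice_sqr; exact: nice_meas_prob_locU.
Qed.

(** Obtained from the probabilistic meaning: with a single round, indexed by ['I_1], this is the
    expectation of a collision probability, and p^2 <= p for each outcome. *)
Lemma mean_purity_01 (R : realType) (n : nat) (psi : bits n -> R[i])
    (S : {set 'I_n}) : normalized psi -> 0 <= mean_purity psi S <= 1.
Proof.
move=> psi1; rewrite -(expect_collision_locU S (ord0 : 'I_1) psi1).
have nc := nice_collision psi S (ord0 : 'I_1).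
have h0 := le_expect (nice_cst _ 0) nc; have h1 := le_expect nc (nice_cst _ 1).
rewrite !expect_cst in h0 h1; apply/andP; split; [apply: h0|apply: h1].
  by move=> th _; apply: sumr_ge0 => z _; exact: sqr_ge0.
move=> th cth; have s1 := sum_meas_prob_locU (ord0 : 'I_1) psi1 cth.
rewrite -[leRHS]s1; apply: ler_sum => z _; rewrite expr2 ler_piMl ?meas_prob_ge0 //.
rewrite -[leRHS]s1 (bigD1 z) //= lerDl; apply: sumr_ge0 => z' _; exact: meas_prob_ge0.
Qed.

Lemma Chat_unbiased (R : realType) (n : nat) (psi : bits n -> R[i])
    (S : {set 'I_n}) (K L : nat) : normalized psi -> (2 <= K)%N -> (1 <= L)%N ->
  Chat_expectation psi S L K = (concentratable_entanglement psi S)%:E.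
Proof.
move=> psi1 K2 L1; rewrite /Chat_expectation unif_E_expect; last exact: nice_weight.
congr EFin; rewrite concentratable_entanglementE.
set c := (3 / 2) ^+ #|S|.
have nS : nice (fun th : params S L -> R =>
    \sum_l \sum_z meas_prob (locU th l) psi z ^+ 2).
  by apply: nice_sum => l _; exact: nice_collision.
have nM := nice_mul (nice_cst _ (- c * L%:R^-1)) nS.
have nf := nice_add (nice_cst _ 1) nM.
(* On the cube the inner mean over outcomes is affine in the collision probabilities of the rounds;
   the target function [nf] records that form. *)
rewrite (eq_expect (nice_weight _ _) nf) => [|th cth].
  rewrite (expectD (nice_cst _ 1) nM) (expectZ _ nS) expect_cst.
  rewrite expect_sum => [|l _]; last exact: nice_collision.
  rewrite (eq_bigr (fun=> mean_purity psi S)) => [|l _]; last first.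
    exact: expect_collision_locU.
  rewrite sumr_const card_ord -[mean_purity _ _ *+ _]mulr_natl mulrA.
  by rewrite mulfVK ?mulNr // pnatr_eq0 -lt0n.
transitivity (\sum_(Z : {ffun 'I_L * 'I_K -> outcome S})
   (outcomes_weight psi th Z + (- c * L%:R^-1) *
    \sum_l outcomes_weight psi th Z * collision_rate R (round_outcomes Z l))).
  apply: eq_bigr => Z _; rewrite -big_distrr /= /Chat -/c.
  by rewrite (eq_bigr _ (fun l _ => ShatE R Z l)); ring.
rewrite big_split /= sum_weight // -big_distrr /= exchange_big /=.
congr (_ + _ * _); apply: eq_bigr => l _.
by rewrite sum_weight_rate.
Qed.

(** * Exponential moments *)

(** From exp(-x) >= 1 - x one gets exp(x) <= 1/(1 - x), and (1 + x + 2 x^2)(1 - x) = 1 + x^2 (1 -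
    2x), which is at least 1 as long as x <= 1/2. *)
Lemma expR_le_quadratic (R : realType) (x : R) :
  `|x| <= 1 / 2 -> expR x <= 1 + x + 2 * x ^+ 2.
Proof.
rewrite ler_norml => /andP[x1 x2].
have x0 : 0 < 1 - x by lra.
have e1 : 1 - x <= expR (- x) by exact: expR_ge1Dx.
have -> : expR x = (expR (- x))^-1 by rewrite expRN invrK.
apply: (le_trans (y := (1 - x)^-1)).
  by rewrite lef_pV2 ?posrE ?expR_gt0.
rewrite -[leLHS]mul1r ler_pdivrMr //.
have : 0 <= x ^+ 2 * (1 - 2 * x) by apply: mulr_ge0; [exact: sqr_ge0|lra].
nra.
Qed.

(** Given the unitary, the quadratic bound has mean 1 + lam (collision probability - mu) + 2 lam^2;
    the linear term vanishes under the Haar average, and 1 + 2 lam^2 <= exp(2 lam^2). The lower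
    bound 0 is what allows the rounds to be multiplied in [mgf_bound]. *)
Lemma mgf_round (R : realType) (n : nat) (psi : bits n -> R[i])
    (S : {set 'I_n}) (K L : nat) (l : 'I_L) (lam : R)
    (mu := mean_purity psi S) :
  normalized psi -> (2 <= K)%N -> `|lam| <= 1 / 2 ->
  0 <= expect (fun th : params S L -> R => iid_mean (meas_prob (locU th l) psi)
      (fun Y : {ffun 'I_K -> outcome S} => expR (lam * (collision_rate R Y - mu))))
    <= expR (2 * lam ^+ 2).
Proof.
move=> psi1 K2 lam2; have /andP[mu0 mu1] : 0 <= mu <= 1 := mean_purity_01 S psi1.
have ng h := @nice_iid_mean R n psi S L K l h.
have h0 := le_expect (nice_cst _ 0) (ng (fun Y => expR (lam * (collision_rate R Y - mu)))).
rewrite expect_cst in h0; apply/andP; split.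
  apply: h0 => th _; apply: sumr_ge0 => Y _; apply: mulr_ge0; last exact: expR_ge0.
  by apply: prodr_ge0 => k _; exact: meas_prob_ge0.
have nc := nice_collision psi S l.
have nM := nice_mul (nice_cst _ lam) nc.
have nB := nice_add (nice_cst _ (1 - lam * mu + 2 * lam ^+ 2)) nM.
apply: (@le_trans _ _ (1 + 2 * lam ^+ 2)); last exact: expR_ge1Dx.
have -> : 1 + 2 * lam ^+ 2 = expect (fun th : params S L -> R =>
    1 - lam * mu + 2 * lam ^+ 2 + lam * \sum_z meas_prob (locU th l) psi z ^+ 2).
  rewrite (expectD (nice_cst _ _) nM) (expectZ _ nc) expect_cst.
  by rewrite expect_collision_locU // -/mu; ring.
apply: le_expect => // th cth.
have s1 := sum_meas_prob_locU l psi1 cth.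
rewrite -(iid_mean_collision_rate K2 s1) -iid_meanZ.
rewrite -(iid_mean_cst K (1 - lam * mu + 2 * lam ^+ 2) s1) -iid_meanD.
apply: le_iid_mean => [z|Y]; first exact: meas_prob_ge0.
have /andP[r0 r1] := collision_rate_01 R Y K2.
set r := collision_rate R Y in r0 r1 *.
have rmu : `|r - mu| <= 1 by rewrite ler_norml; apply/andP; split; lra.
apply: le_trans (expR_le_quadratic _) _.
  by rewrite normrM -[leRHS]mulr1 ler_pM.
have : lam ^+ 2 * (r - mu) ^+ 2 <= lam ^+ 2.
  rewrite ler_piMr ?sqr_ge0 // -real_normK ?num_real //.
  by rewrite expr_le1.
rewrite exprMn; lra.
Qed.

(** Independence enters twice: for fixed unitaries the outcomes factor by rounds, and then the
    factors of different rounds read disjoint parameters. *)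
Lemma mgf_bound (R : realType) (n : nat) (psi : bits n -> R[i])
    (S : {set 'I_n}) (K L : nat) (lam : R) :
  normalized psi -> (2 <= K)%N -> `|lam| <= 1 / 2 ->
  expect (fun th : params S L -> R => \sum_(Z : {ffun 'I_L * 'I_K -> outcome S})
    outcomes_weight psi th Z *
      expR (lam * \sum_l (collision_rate R (round_outcomes Z l) - mean_purity psi S))) <=
  expR (2 * lam ^+ 2 * L%:R).
Proof.
move=> psi1 K2 lam2; set mu := mean_purity psi S.
pose h (Y : {ffun 'I_K -> outcome S}) := expR (lam * (collision_rate R Y - mu)).
pose H l (th : params S L -> R) := iid_mean (meas_prob (locU th l) psi) h.
have -> : (fun th : params S L -> R => \sum_(Z : {ffun 'I_L * 'I_K -> outcome S})
    outcomes_weight psi th Z *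
      expR (lam * \sum_l (collision_rate R (round_outcomes Z l) - mu))) =
    (fun th => \prod_l H l th).
  apply: funext => th; rewrite -(sum_weight_prod psi th (fun=> h)).
  by apply: eq_bigr => Z _; rewrite big_distrr /= expR_sum.
rewrite (expect_prod (A := fun l (i : params S L) => i.1.1 == l)).
- apply: (@le_trans _ _ (\prod_(l < L) expR (2 * lam ^+ 2))).
    by apply: ler_prod => l _; exact: mgf_round.
  by rewrite prodr_const card_ord -expRM_natr.
- exact: index_enum_uniq.
- by move=> l; exact: nice_iid_mean.
- move=> l th th' e; have ev : locU th l = locU th' l.
    by apply: funext => j; congr haarU; apply: funext => r; exact: e.
  by rewrite /H ev.
- by move=> l l' [[i j] r] /= ll' /eqP ->.
Qed.

(** * Two-sided tail of the estimator *)

Lemma Chat_deviation_bound (R : realType) (n : nat) (psi : bits n -> R[i])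
    (S : {set 'I_n}) (K L : nat) (eps delta : R) :
  normalized psi -> (2 <= K)%N -> (1 <= L)%N -> 0 < eps -> 0 < delta < 1 ->
  8 * (9 / 4) ^+ #|S| * ln (2 / delta) / eps ^+ 2 <= L%:R ->
  (Chat_deviation_prob psi S L K eps <= delta%:E)%E.
Proof.
move=> psi1 K2 L1 eps0 /andP[d0 d1] hL.
rewrite /Chat_deviation_prob unif_E_expect ?lee_fin; last exact: nice_weight.
set mu := mean_purity psi S; set c := (3 / 2) ^+ #|S| : R.
have c0 : 0 < c by rewrite exprn_gt0 //; lra.
have L0 : 0 < L%:R :> R by rewrite ltr0n.
pose t := eps / c; have t0 : 0 < t by rewrite divr_gt0.
pose X (Z : {ffun 'I_L * 'I_K -> outcome S}) : R :=
  \sum_l (collision_rate R (round_outcomes Z l) - mu).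
(* The error of the estimator is -(c/L) times the centred sum [X Z], so precision [eps] amounts to a
   deviation t = eps/c per round. *)
have dev Z : (eps <= `|Chat R Z - concentratable_entanglement psi S|) =
    (L%:R * t <= `|X Z|).
  have XE : X Z = \sum_l collision_rate R (round_outcomes Z l) - L%:R * mu.
    by rewrite /X big_split /= sumr_const card_ord mulNrn mulr_natl.
  have -> : Chat R Z - concentratable_entanglement psi S = - (c / L%:R * X Z).
    rewrite concentratable_entanglementE /Chat -/c -/mu.
    rewrite (eq_bigr _ (fun l _ => ShatE R Z l)) XE; field.
    by rewrite pnatr_eq0 -lt0n.
  rewrite normrN normrM (gtr0_norm (divr_gt0 c0 L0)) /t mulrA ler_pdivrMr //.
  by rewrite mulrAC ler_pdivlMr // mulrC [_ * c]mulrC.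
(* For t > 1 a deviation is impossible, since every summand of [X Z] has absolute value at most 1.
   The other case keeps [lam] below within the range of [mgf_bound]. *)
have [t1|t1] := ltP 1 t.
  have -> : (fun th : params S L -> R => \sum_(Z : {ffun 'I_L * 'I_K -> outcome S})
      outcomes_weight psi th Z *
      ((eps <= `|Chat R Z - concentratable_entanglement psi S|)%R)%:R) = (fun=> 0).
    apply: funext => th; rewrite big1 // => Z _; rewrite dev.
    suff /negbTE -> : ~~ (L%:R * t <= `|X Z|) by rewrite mulr0.
    rewrite -ltNge; apply: (@le_lt_trans _ _ L%:R); last by rewrite ltr_pMr.
    apply: (le_trans (ler_norm_sum _ _ _)).
    rewrite -[leRHS]mulr1 mulr_natl -[L in leRHS]card_ord -sumr_const.
    apply: ler_sum => l _; have /andP[r0 r1] := collision_rate_01 R (round_outcomes Z l) K2.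
    have /andP[m0 m1] : 0 <= mu <= 1 := mean_purity_01 S psi1.
    by rewrite ler_norml; apply/andP; split; lra.
  by rewrite expect_cst ltW.
(* The minimizer of -lam t + 2 lam^2, whose minimum is -t^2/8. *)
pose lam := t / 4.
have lam2 : `|lam| <= 1 / 2 by rewrite ger0_norm /lam; lra.
have lamN2 : `|- lam| <= 1 / 2 by rewrite normrN.
pose W a (th : params S L -> R) := \sum_(Z : {ffun 'I_L * 'I_K -> outcome S})
  outcomes_weight psi th Z * expR (a * X Z).
have nW a : nice (W a) by exact: nice_weight.
have nWW := nice_mul (nice_cst _ (expR (- (lam * (L%:R * t)))))
  (nice_add (nW lam) (nW (- lam))).
(* Markov's inequality for both tails at once, applied to the indicator before integration:
   whichever sign [X Z] has, one of the two exponentials is already at least 1 on the event. *)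
apply: (@le_trans _ _ (expect (fun th => expR (- (lam * (L%:R * t))) *
    (W lam th + W (- lam) th)))).
  apply: le_expect => //; first exact: nice_weight.
  move=> th _; rewrite -big_split big_distrr /=; apply: ler_sum => Z _.
  rewrite -mulrDr mulrCA; apply: ler_wpM2l.
    by rewrite outcomes_weightE; apply: prodr_ge0 => l _; apply: prodr_ge0 => k _;
      exact: meas_prob_ge0.
  rewrite dev mulrDr -!expRD; case: (leP (L%:R * t) `|X Z|) => [hX|_]; last first.
    by apply: addr_ge0; exact: expR_ge0.
  have lam0 : 0 <= lam by rewrite /lam; lra.
  have [X0|X0] := leP 0 (X Z).
    rewrite ger0_norm // in hX.
    apply: (@le_trans _ _ (expR (- (lam * (L%:R * t)) + lam * X Z))).
      apply: (@le_trans _ _ (expR 0)); first by rewrite expR0.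
      by rewrite ler_expR addrC subr_ge0 ler_wpM2l.
    by rewrite lerDl expR_ge0.
  rewrite ltr0_norm // in hX.
  apply: (@le_trans _ _ (expR (- (lam * (L%:R * t)) + - lam * X Z))).
    apply: (@le_trans _ _ (expR 0)); first by rewrite expR0.
    by rewrite ler_expR addrC subr_ge0 mulNr -mulrN ler_wpM2l.
  by rewrite lerDr expR_ge0.
rewrite (expectZ _ (nice_add (nW _) (nW _))) (expectD (nW _) (nW _)).
apply: (@le_trans _ _ (expR (- (lam * (L%:R * t))) *
    (expR (2 * lam ^+ 2 * L%:R) + expR (2 * (- lam) ^+ 2 * L%:R)))).
  by apply: ler_wpM2l; [exact: expR_ge0|apply: lerD; exact: mgf_bound].
rewrite sqrrN mulrDr -!expRD.
have -> : - (lam * (L%:R * t)) + 2 * lam ^+ 2 * L%:R = - (L%:R * t ^+ 2 / 8).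
  by rewrite /lam; field.
have c2 : c ^+ 2 = (9 / 4) ^+ #|S|.
  by rewrite -exprM mulnC exprM; congr (_ ^+ _); field.
(* As t = eps/c and c^2 = (9/4)^s, this is exactly the sample size hypothesis; the 2 inside the
   logarithm pays for the two tails. *)
have hln : ln (2 / delta) <= L%:R * t ^+ 2 / 8.
  move: hL; rewrite ler_pdivrMr ?exprn_gt0 // -c2 => hL.
  rewrite ler_pdivlMr // /t expr_div_n mulrA ler_pdivlMr ?exprn_gt0 //.
  lra.
have le1 : expR (- (L%:R * t ^+ 2 / 8)) <= delta / 2.
  rewrite -[leRHS]lnK ?posrE ?divr_gt0 // ler_expR.
  rewrite -(invf_div 2 delta) lnV ?posrE ?divr_gt0 //.
  by rewrite lerN2.
lra.
Qed.

Theorem theorem1 :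
  (forall (R : realType) (n : nat) (psi : bits n -> R[i]) (S : {set 'I_n})
      (K L : nat),
    normalized psi -> S != finset.set0 -> (2 <= K)%N -> (1 <= L)%N ->
    Chat_expectation psi S L K = (concentratable_entanglement psi S)%:E)
  /\
  (exists c : nat,
    forall (R : realType) (n : nat) (psi : bits n -> R[i]) (S : {set 'I_n})
      (K L : nat) (eps delta : R),
    normalized psi -> S != finset.set0 -> (2 <= K)%N -> (1 <= L)%N ->
    0 < eps -> 0 < delta < 1 ->
    c%:R * (9 / 4) ^+ #|S| * ln (2 / delta) / eps ^+ 2 <= L%:R ->
    (Chat_deviation_prob psi S L K eps <= delta%:E)%E).
Proof.
split=> [R n psi S K L psi1 _ K2 L1|]; first exact: Chat_unbiased.
(* The 8 is the denominator of the exponent -L t^2/8. For delta <= 1/2 the logarithm of 2/delta is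
   at most twice that of 1/delta. *)
exists 8 => R n psi S K L eps delta psi1 _ K2 L1 eps0 d01 hL.
exact: Chat_deviation_bound hL.
Qed.
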